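(* Let $m\ge1$, $1\leq p<2$, and let $\omega$ be a continuous nondecreasing function on $[0,+\infty)$ with $\omega(0)=0$; let $\chi(\delta)=\delta\omega(\delta)$ and let $\chi^{-1}$ be its inverse function. Let $V$ be a domain in $\mathbb R^m$ and let $\varphi\in C^{1,\omega}(V)$ be a real function such that $\nabla\varphi(V)$ has positive Lebesgue measure. Then there is $c>0$ independent of $\lambda$ such that $$\|e^{i\lambda\varphi}\|_{A_p(\mathbb R^m,V)}\geq c\Big(|\lambda|^{1/p}\chi^{-1}\Big(\frac1{|\lambda|}\Big)\Big)^m$$ for all $\lambda\in\mathbb R$ with $|\lambda|\geq1$ for which $e^{i\lambda\varphi}\in A_p(\mathbb R^m,V)$.
   Context: The Fourier transform on $\mathbb R^m$ is normalized by $\widehat f(u)=(2\pi)^{-m}\int_{\mathbb R^m}f(t)e^{-i(u,t)}dt$ for $f\in L^1(\mathbb R^m)$ (extended to tempered distributions). For $1\le p\le\infty$, $A_p(\mathbb R^m)$ is the space of tempered distributions $f$ on $\mathbb R^m$ with $\widehat f\in L^p(\mathbb R^m)$, $\|f\|_{A_p(\mathbb R^m)}=\|\widehat f\|_{L^p(\mathbb R^m)}$ (for $p=1$, $f$ is taken continuous). For a set $E\subseteq\mathbb R^m$, a function $f$ on $E$ belongs to $A_p(\mathbb R^m,E)$ if there is $F\in A_p(\mathbb R^m)$ with $F|_E=f$; $\|f\|_{A_p(\mathbb R^m,E)}=\inf\{\|F\|_{A_p(\mathbb R^m)}:F|_E=f\}$. For a domain $V$ and $g$ on $V$, $\omega(V,g,\delta)=\sup\{|g(t_1)-g(t_2)|:t_1,t_2\in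 V,|t_1-t_2|\le\delta\}$; $C^{1,\omega}(V)$ is the class of functions on $V$ whose first-order partial derivatives $g$ satisfy $\omega(V,g,\delta)=O(\omega(\delta))$ as $\delta\to+0$. *)

(* Defs.v *)
From HB Require Import structures.
From mathcomp Require Import all_boot all_order all_algebra.
From mathcomp Require Import all_classical all_reals all_analysis.

Set Implicit Arguments.
Unset Strict Implicit.
Unset Printing Implicit Defensive.

Import Order.TTheory GRing.Theory Num.Theory.
Import numFieldNormedType.Exports.
Local Open Scope classical_set_scope.
Local Open Scope ring_scope.

Section Defs.
Variable R : realType.

Definition dotR (m : nat) (u t : 'rV[R]_m) : R := \sum_(i < m) u 0 i * t 0 i.
Definition enorm (m : nat) (t : 'rV[R]_m) : R := Num.sqrt (dotR t t).

Fixpoint iint (m : nat) : ('rV[R]_m -> \bar R) -> \bar R :=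
  match m with
  | 0 => fun f => f 0
  | m'.+1 => fun f =>
      (\int[@lebesgue_measure R]_x iint (fun y : 'rV[R]_m' =>
          f (row_mx (const_mx x : 'rV[R]_1) y)))%E
  end.

Definition borel_meas (m : nat) (g : 'rV[R]_m -> R) : Prop :=
  forall B : set R, open B -> (<<s (@open 'rV[R]_m) >>) (g @^-1` B).

Definition rbox (m : nat) (a b : 'rV[R]_m) : set 'rV[R]_m :=
  [set t | forall i, a 0 i <= t 0 i < b 0 i].
Definition rvol (m : nat) (a b : 'rV[R]_m) : R := \prod_(i < m) (b 0 i - a 0 i).
Definition leb_outer (m : nat) (S : set 'rV[R]_m) : \bar R :=
  ereal_inf [set (\sum_(0 <= k <oo) (rvol (ab.1 k) (ab.2 k))%:E)%E
            | ab in [set ab : (nat -> 'rV[R]_m) * (nat -> 'rV[R]_m) |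
                     (forall k i, ab.1 k 0 i <= ab.2 k 0 i) /\
                     S `<=` \bigcup_k rbox (ab.1 k) (ab.2 k)]].

(** Complex-valued functions are represented by (real part, imaginary part).
    L^p norm (1 <= p < oo) of g = g1 + i g2 on R^m, as an extended real. *)
Definition Lp_norm (m : nat) (p : R) (g1 g2 : 'rV[R]_m -> R) : \bar R :=
  poweR (iint (fun u => (powR (Num.sqrt (g1 u ^+ 2 + g2 u ^+ 2)) p)%:E)) p^-1.

Definition in_Lp (m : nat) (p : R) (g1 g2 : 'rV[R]_m -> R) : Prop :=
  borel_meas g1 /\ borel_meas g2 /\
  (iint (fun u => (powR (Num.sqrt (g1 u ^+ 2 + g2 u ^+ 2)) p)%:E) < +oo)%E.

Definition test_fun (m : nat) (V : set 'rV[R]_m) (psi : 'rV[R]_m -> R) : Prop :=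
  continuous psi /\
  exists K : set 'rV[R]_m, [/\ compact K, K `<=` V & forall t, ~ K t -> psi t = 0].

(** psi~(u) = \int psi(t) e^{i(u,t)} dt, real and imaginary parts. *)
Definition ftc (m : nat) (psi : 'rV[R]_m -> R) (u : 'rV[R]_m) : \bar R :=
  iint (fun t => (psi t * cos (dotR u t))%:E).
Definition fts (m : nat) (psi : 'rV[R]_m -> R) (u : 'rV[R]_m) : \bar R :=
  iint (fun t => (psi t * sin (dotR u t))%:E).

(** "F|_V = f1 + i f2" where F is the tempered distribution with
    \hat F = g1 + i g2 (normalization \hat f(u) = (2pi)^-m \int f e^{-i(u,t)}):
    for every test function psi supported in V,
    \int_V f psi = <F, psi> = \int g(u) psi~(u) du. *)
Definition ift_eq_on (m : nat) (V : set 'rV[R]_m) (g1 g2 f1 f2 : 'rV[R]_m -> R) :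
  Prop :=
  forall psi, test_fun V psi ->
    iint (fun t => (f1 t * psi t)%:E) =
      iint (fun u => ((g1 u)%:E * ftc psi u - (g2 u)%:E * fts psi u)%E) /\
    iint (fun t => (f2 t * psi t)%:E) =
      iint (fun u => ((g1 u)%:E * fts psi u + (g2 u)%:E * ftc psi u)%E).

Definition in_Ap_on (m : nat) (p : R) (V : set 'rV[R]_m) (f1 f2 : 'rV[R]_m -> R) :
  Prop :=
  exists g1 g2, in_Lp p g1 g2 /\ ift_eq_on V g1 g2 f1 f2.

Definition Ap_norm_on (m : nat) (p : R) (V : set 'rV[R]_m) (f1 f2 : 'rV[R]_m -> R) :
  \bar R :=
  ereal_inf [set Lp_norm p gg.1 gg.2 | gg in
     [set gg : ('rV[R]_m -> R) * ('rV[R]_m -> R) |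
        in_Lp p gg.1 gg.2 /\ ift_eq_on V gg.1 gg.2 f1 f2]].

Definition unit_vec (m : nat) (k : 'I_m) : 'rV[R]_m := delta_mx 0 k.
Definition partial (m : nat) (k : 'I_m) (phi : 'rV[R]_m -> R) (t : 'rV[R]_m) : R :=
  'D_(unit_vec k) phi t.
Definition grad (m : nat) (phi : 'rV[R]_m -> R) (t : 'rV[R]_m) : 'rV[R]_m :=
  \row_k partial k phi t.

Definition domain (m : nat) (V : set 'rV[R]_m) : Prop :=
  [/\ open V, connected V & V !=set0].

Definition C1omega (m : nat) (omega : R -> R) (V : set 'rV[R]_m)
  (phi : 'rV[R]_m -> R) : Prop :=
  (forall t k, V t -> derivable phi t (unit_vec k)) /\
  forall k : 'I_m, exists C : R, exists d0 : R, 0 < d0 /\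
    forall d, 0 < d -> d <= d0 ->
      forall t1 t2, V t1 -> V t2 -> enorm (t1 - t2) <= d ->
        `|partial k phi t1 - partial k phi t2| <= C * omega d.

End Defs.

(* Main.v *)
(* On a cube of side comparable to D = eps * chi^-1(1/|lambda|) around t the phase
   lambda * phi is affine up to 1/4, so testing e^{i lambda phi} against a tent of width D
   modulated by the frequency v = lambda * grad phi(t) gives D^{2m} <~ \int |g| K(. -+ v),
   where K is the transform of the tent.  Young's inequality |g| <= e + e^{1-p} |g|^p with
   e ~ D^m absorbs the first term, and leaves D^{2m} e^{p-1} <~ \int |g|^p K(. -+ v).
   This kernel may be replaced by one centered at a point of the lattice D^-1 Z^m next to v.
   The sum over the lattice points met by lambda * grad phi(V') bounds their number, hence the
   outer measure of grad phi(V'), by a multiple of ||g||_p^p (D |lambda|^{1/p})^{-mp}.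
   Here V' is the set of points of V at distance >= 1/n from the complement where the gradient
   is at most n; for some n its image under grad phi is not a null set.

   The integral of an arbitrary nonnegative function is its lower integral, so [iint] can be
   handled through inequalities that hold for all functions (monotonicity,
   superadditivity, subadditivity when one summand is a product of measurable functions of
   one variable): neither measurability on R^m nor Fubini is needed. *)
Require Import Defs.
From HB Require Import structures.
From mathcomp Require Import all_boot all_order all_algebra.
From mathcomp Require Import all_classical all_reals all_analysis.
From mathcomp Require Import measurable_realfun ring lra.

Set Implicit Arguments.
Unset Strict Implicit.
Unset Printing Implicit Defensive.
Import Order.TTheory GRing.Theory Num.Theory.
Import numFieldNormedType.Exports.
Local Open Scope classical_set_scope.
Local Open Scope ring_scope.

(** * Integrals of arbitrary functions *)

Section lower_integral.
Context d (T : measurableType d) (R : realType).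
Variable mu : {measure set T -> \bar R}.
Local Open Scope ereal_scope.
Import HBNNSimple.
Implicit Types f g : T -> \bar R.

(** For nonnegative functions the integral is a supremum over the simple functions below, which
    grows with the function. Positive and negative parts give the signed case. *)
Lemma le_lower_integral f g : (forall x, f x <= g x) ->
  \int[mu]_x f x <= \int[mu]_x g x.
Proof.
have ge0_le f' g' : (forall x, 0 <= f' x) -> (forall x, f' x <= g' x) ->
    \int[mu]_x f' x <= \int[mu]_x g' x.
  move=> f0 fg; rewrite !ge0_integralTE//; last by move=> x; exact: le_trans (fg x).
  by apply: ereal_sup_le => _ [h /= hf <-]; exists h => // x; exact: le_trans (fg x).
move=> fg; rewrite integralE [leRHS]integralE; apply: leeB; apply: ge0_le => // x.
- exact: (@funepos_le _ _ setT f g (fun x _ => fg x) x (in_setT x)).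
- exact: (@funeneg_le _ _ setT f g (fun x _ => fg x) x (in_setT x)).
Qed.

(** A simple function below [f] plus one below [g] is a simple function below [f + g]. Suprema are
    taken one at a time, infinite values apart, since subtraction in the extended reals requires
    finiteness. *)
Lemma lower_integralD_ge f g : (forall x, 0 <= f x) -> (forall x, 0 <= g x) ->
  \int[mu]_x f x + \int[mu]_x g x <= \int[mu]_x (f x + g x).
Proof.
move=> f0 g0; rewrite (ge0_integralTE mu f0) (ge0_integralTE mu g0).
set I := \int[mu]_x _.
have I0 : 0 <= I by apply: integral_ge0 => x _; rewrite adde_ge0.
have step (h : {nnsfun T >-> R}) : (forall x, (h x)%:E <= g x) ->
    ereal_sup [set sintegral mu h0 | h0 in
      [set h0 : {nnsfun T >-> R} | forall x, (h0 x)%:E <= f x]] + sintegral mu h <= I.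
  move=> hg; have [hfin|] := boolP (sintegral mu h \is a fin_num); last first.
    rewrite ge0_fin_numE ?sintegral_ge0// -leNgt leye_eq => /eqP hoo.
    suff -> : I = +oo by rewrite leey.
    apply/eqP; rewrite -leye_eq -hoo -integralT_nnsfun; apply: le_lower_integral => x.
    by apply: (le_trans (hg x)); rewrite leeDr.
  rewrite -leeBrDr//; apply: ge_ereal_sup => _ [h0 /= h0f <-].
  rewrite leeBrDr// -sintegralD -/(sintegral mu (add_nnsfun h0 h)) -integralT_nnsfun.
  by apply: le_lower_integral => x /=; rewrite EFinD leeD.
set F := ereal_sup _ in step *.
have F0 : 0 <= F.
  by apply: ereal_sup_ubound; exists nnsfun0 => //; exact: sintegral0.
(* If [F] is infinite, [step] with the zero function already makes [I] infinite. *)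
have [Ffin|] := boolP (F \is a fin_num); last first.
  rewrite ge0_fin_numE// -leNgt leye_eq => /eqP Foo.
  have := step nnsfun0 (fun x => g0 x).
  rewrite Foo addye; last by rewrite sintegral0.
  by rewrite leye_eq => /eqP ->; rewrite leey.
rewrite addeC -leeBrDr//; apply: ge_ereal_sup => _ [h /= hg <-].
by rewrite leeBrDr// addeC; exact: step.
Qed.

(** The integrals of the positive and negative parts add up to at most that of [|f|] by
    superadditivity. *)
Lemma abse_lower_integral f : `|\int[mu]_x f x| <= \int[mu]_x `|f x|.
Proof.
rewrite integralE; apply: (le_trans (lee_abs_sub _ _)).
rewrite !gee0_abs ?integral_ge0//.
apply: (le_trans (lower_integralD_ge _ _)) => //.
by apply: le_lower_integral => x; rewrite [leRHS](_ : _ = (abse \o f) x)// fune_abse.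
Qed.

(** Scaling simple functions gives one inequality; the same inequality for [c^-1] gives the
    other. *)
Lemma lower_integralZl (c : R) f : (0 < c)%R -> (forall x, 0 <= f x) ->
  \int[mu]_x (c%:E * f x) = c%:E * \int[mu]_x f x.
Proof.
have le_int c' f' : (0 < c')%R -> (forall x, 0 <= f' x) ->
    c'%:E * \int[mu]_x f' x <= \int[mu]_x (c'%:E * f' x).
  move=> c0 f0; rewrite (ge0_integralTE mu f0) -lee_pdivlMl//.
  apply: ge_ereal_sup => _ [h /= hf <-]; rewrite lee_pdivlMl//.
  rewrite -sintegralrM.
  rewrite (_ : sintegral _ _ = sintegral mu (scale_nnsfun h (ltW c0)))// -integralT_nnsfun.
  by apply: le_lower_integral => x /=; rewrite EFinM lee_pmul2l.
move=> c0 f0; apply/eqP; rewrite eq_le le_int// andbT.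
rewrite -lee_pdivrMl//; apply: (le_trans (le_int _ _ _ _)).
- by rewrite invr_gt0.
- by move=> x; rewrite mule_ge0// lee_fin ltW.
- by apply: le_lower_integral => x; rewrite muleA -EFinM mulVf ?gt_eqF// mul1e.
Qed.

(** For a simple [h <= f + g], the function [k = max (h - f, 0)] is measurable because [f] is, and
    satisfies [h <= f + k] and [k <= g]. Additivity is then used only for the measurable pair [f],
    [k]. *)
Lemma lower_integralD_le (f : T -> R) g : measurable_fun setT f ->
  (forall x, (0 <= f x)%R) -> (forall x, 0 <= g x) ->
  \int[mu]_x ((f x)%:E + g x) <= \int[mu]_x (f x)%:E + \int[mu]_x g x.
Proof.
move=> mf f0 g0; rewrite ge0_integralTE; last first.
  by move=> x; rewrite adde_ge0// lee_fin.
apply: ge_ereal_sup => _ [h /= hf <-].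
rewrite -integralT_nnsfun.
pose k x := Num.max (h x - f x)%R 0%R.
have mk : measurable_fun setT k.
  by by apply: measurable_maxr => //; apply: measurable_funB.
have k0 x : (0 <= k x)%R by rewrite le_max lexx orbT.
apply: (@le_trans _ _ (\int[mu]_x ((f x)%:E + (k x)%:E))).
  apply: le_lower_integral => x; rewrite -EFinD lee_fin -lerBlDl.
  by rewrite le_max lexx.
rewrite ge0_integralD//=; [|by move=> *; rewrite lee_fin|exact/measurable_EFinP
  |by move=> *; rewrite lee_fin|exact/measurable_EFinP].
apply: leeD2l; apply: le_lower_integral => x; rewrite /k EFin_max ge_max g0 andbT.
by rewrite EFinB leeBlDl// fin_numE.
Qed.

End lower_integral.

(** * Iterated integrals over R^m *)

Section iint.
Variable R : realType.
Implicit Types m n : nat.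

Definition rowcons m (x : R) (y : 'rV[R]_m) : 'rV[R]_m.+1 :=
  row_mx (const_mx x : 'rV[R]_1) y.

Lemma rowcons0 m x (y : 'rV[R]_m) : rowcons x y 0 ord0 = x.
Proof.
rewrite /rowcons (_ : ord0 = lshift m (ord0 : 'I_1)); last exact: val_inj.
by rewrite (row_mxEl (const_mx x : 'rV[R]_1)) mxE.
Qed.

Lemma rowconsS m x (y : 'rV[R]_m) i : rowcons x y 0 (lift ord0 i) = y 0 i.
Proof.
rewrite /rowcons (_ : lift ord0 i = rshift 1 i); last exact: val_inj.
by rewrite (row_mxEr (const_mx x : 'rV[R]_1)).
Qed.

Lemma prod_rowcons m (q : 'I_m.+1 -> R -> R) x (y : 'rV[R]_m) :
  \prod_i q i (rowcons x y 0 i) = q ord0 x * \prod_i q (lift ord0 i) (y 0 i).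
Proof.
rewrite big_ord_recl rowcons0; congr (_ * _).
by apply: eq_bigr => i _; rewrite rowconsS.
Qed.

Lemma dotR_rowcons m (w : 'rV[R]_m.+1) x (y : 'rV[R]_m) :
  dotR w (rowcons x y) = w 0 ord0 * x + dotR (\row_i w 0 (lift ord0 i)) y.
Proof.
rewrite /dotR big_ord_recl rowcons0; congr (_ + _).
by apply: eq_bigr => i _; rewrite rowconsS mxE.
Qed.

Local Open Scope ereal_scope.

Lemma iintS m (f : 'rV[R]_m.+1 -> \bar R) :
  iint f = \int[@lebesgue_measure R]_x iint (fun y => f (rowcons x y)).
Proof. by []. Qed.

Lemma eq_iint m (f g : 'rV[R]_m -> \bar R) : (forall t, f t = g t) -> iint f = iint g.
Proof. by move=> /funext ->. Qed.

Lemma le_iint m (f g : 'rV[R]_m -> \bar R) : (forall t, f t <= g t) ->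
  iint f <= iint g.
Proof.
elim: m f g => [|m IH] f g fg; first exact: fg.
by rewrite !iintS; apply: le_lower_integral => x; apply: IH => y; exact: fg.
Qed.

Lemma iint_ge0 m (f : 'rV[R]_m -> \bar R) : (forall t, 0 <= f t) -> 0 <= iint f.
Proof.
elim: m f => [|m IH] f f0; first exact: f0.
by rewrite iintS; apply: integral_ge0 => x _; exact: IH.
Qed.

Lemma iintD_ge m (f g : 'rV[R]_m -> \bar R) :
  (forall t, 0 <= f t) -> (forall t, 0 <= g t) ->
  iint f + iint g <= iint (fun t => f t + g t).
Proof.
elim: m f g => [|m IH] f g f0 g0; first by [].
rewrite !iintS; apply: (le_trans (lower_integralD_ge _ _ _)).
- by move=> x; exact: iint_ge0.
- by move=> x; exact: iint_ge0.
- by apply: le_lower_integral => x; exact: IH.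
Qed.

Lemma iint_sum_ge m (I : Type) (s : seq I) (P : pred I)
    (f : I -> 'rV[R]_m -> \bar R) :
  (forall i t, 0 <= f i t) ->
  \sum_(i <- s | P i) iint (f i) <= iint (fun t => \sum_(i <- s | P i) f i t).
Proof.
move=> f0; elim: s => [|i s IH].
  by rewrite big_nil; apply: iint_ge0 => t; rewrite big_nil.
rewrite big_cons [X in _ <= iint X](_ : _ = fun t =>
   if P i then f i t + \sum_(j <- s | P j) f j t else \sum_(j <- s | P j) f j t);
  last by apply/funext => t; rewrite big_cons.
case: (P i) => //; apply: (le_trans _ (iintD_ge _ _)) => //; first exact: leeD2l.
by move=> t; apply: sume_ge0.
Qed.

Lemma abse_iint m (f : 'rV[R]_m -> \bar R) : `|iint f| <= iint (fun t => `|f t|).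
Proof.
elim: m f => [|m IH] f; first by [].
rewrite !iintS; apply: (le_trans (abse_lower_integral _ _)).
by apply: le_lower_integral => x; exact: IH.
Qed.

Lemma iintZl m (c : R) (f : 'rV[R]_m -> \bar R) : (0 < c)%R ->
  (forall t, 0 <= f t) -> iint (fun t => c%:E * f t) = c%:E * iint f.
Proof.
move=> c0; elim: m f => [|m IH] f f0; first by [].
rewrite !iintS -lower_integralZl//; last by move=> x; exact: iint_ge0.
by congr integral; apply/funext => x; rewrite IH.
Qed.

(** At each level of the iteration the product summand has become a multiple of a measurable
    function of the outer variable, so [lower_integralD_le] applies. The coefficient [a] collects
    the factors of the variables already fixed. *)
Lemma iintD_prod_le m (a I : R) (q : 'I_m -> R -> R) (g : 'rV[R]_m -> \bar R) :
  (0 <= a)%R -> (0 <= I)%R -> (forall i x, (0 <= q i x)%R) ->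
  (forall i, measurable_fun setT (q i)) ->
  (forall i, \int[@lebesgue_measure R]_x (q i x)%:E <= I%:E) ->
  (forall t, 0 <= g t) ->
  iint (fun t => (a * \prod_i q i (t 0%R i))%:E + g t) <= (a * I ^+ m)%:E + iint g.
Proof.
move=> a0 I0; elim: m a a0 q g => [|m IH] a a0 q g q0 mq qI g0.
  by rewrite /= big_ord0 expr0.
rewrite !iintS.
apply: (@le_trans _ _ (\int[@lebesgue_measure R]_x
   ((a * I ^+ m * q ord0 x)%:E + iint (fun y => g (rowcons x y))))).
  apply: le_lower_integral => x.
  apply: (le_trans _ (le_trans (IH (a * q ord0 x)%R _ (fun i => q (lift ord0 i))
    (fun y => g (rowcons x y)) _ _ _ _) _)) => //.
  - by apply: le_iint => y; rewrite prod_rowcons mulrA.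
  - by rewrite mulr_ge0.
  - by rewrite mulrAC.
have mc : measurable_fun setT (fun x => (a * I ^+ m * q ord0 x)%R).
  exact: (measurable_funM (measurable_cst _) (mq _)).
apply: (le_trans (lower_integralD_le _ _ _ _)).
- exact: mc.
- by move=> x; rewrite !mulr_ge0// exprn_ge0.
- by move=> x; apply: iint_ge0.
apply: leeD2r.
(* The zero coefficient is separate because [lower_integralZl] takes a positive constant. *)
have [->|aI] := eqVneq (a * I ^+ m)%R 0%R.
  under eq_integral do rewrite mul0r.
  by rewrite integral0_eq// lee_fin !mulr_ge0// exprn_ge0.
have {}aI : (0 < a * I ^+ m)%R by rewrite lt_neqAle eq_sym aI mulr_ge0// exprn_ge0.
under eq_integral do rewrite EFinM.
rewrite lower_integralZl//; last by move=> x; rewrite lee_fin.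
by rewrite exprSr mulrA [leRHS]EFinM lee_pmul2l.
Qed.

End iint.

(** * The Fourier transform of a tent *)

Section tent.
Variable R : realType.
Implicit Types (a b c x w th D : R).
Local Notation mu := (@lebesgue_measure R).

Lemma derivable_continuous (f : R -> R) : (forall x, derivable f x 1) -> continuous f.
Proof. by move=> df x; apply: differentiable_continuous; exact/derivable1_diffP. Qed.

Lemma integral_is_derive (F f : R -> R) a b : a < b ->
  (forall x, is_derive x 1 F (f x)) -> continuous f ->
  (\int[mu]_(x in `[a, b]) (f x)%:E = (F b - F a)%:E)%E.
Proof.
move=> ab dF cf.
have cF : continuous F by apply: derivable_continuous => x; apply: ex_derive.
rewrite (@continuous_FTC2 _ f F)//.
- exact: continuous_subspaceT.
- split; first by move=> x _; apply: ex_derive.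
  + exact/cvg_at_right_filter/cF.
  + exact/cvg_at_left_filter/cF.
- by move=> x _; rewrite derive1E; apply: derive_val.
Qed.

Lemma is_derive_affine (al be x : R) : is_derive x (1 : R) (fun y : R => al + be * y) be.
Proof.
apply: (is_derive_eq (is_deriveD (is_derive_cst al x 1) (is_deriveZ be (is_derive_id x 1)))).
by rewrite add0r /GRing.scale /= mulr1.
Qed.

Lemma is_derive_sin_affine (th w x : R) :
  is_derive x (1 : R) (fun y : R => sin (th + w * y)) (w * cos (th + w * x)).
Proof.
by apply: (is_derive_eq (is_derive1_comp (is_derive_sin _) (is_derive_affine th w x))); rewrite
  mulrC.
Qed.

Lemma is_derive_cos_affine (th w x : R) :
  is_derive x (1 : R) (fun y : R => cos (th + w * y)) (- (w * sin (th + w * x))).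
Proof.
by apply: (is_derive_eq (is_derive1_comp (is_derive_cos _) (is_derive_affine th w x))); rewrite
  mulNr mulrC.
Qed.

Lemma continuous_affine_cos (al be th w : R) :
  continuous (fun x : R => (al + be * x) * cos (th + w * x)).
Proof.
apply: derivable_continuous => x.
have := is_deriveM (is_derive_affine al be x) (is_derive_cos_affine th w x).
by move=> h; exact: (@ex_derive _ _ _ _ _ _ _ h).
Qed.

Lemma integral_affine_cos (al be th w a b : R) : a < b -> w != 0 ->
  (\int[mu]_(x in `[a, b]) ((al + be * x) * cos (th + w * x))%:E =
   (((al + be * b) * sin (th + w * b) / w + be * cos (th + w * b) / w ^+ 2) -
   ((al + be * a) * sin (th + w * a) / w + be * cos (th + w * a) / w ^+ 2))%:E)%E.
Proof.
move=> ab w0.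
(* The antiderivative comes from integration by parts. *)
pose F (x : R) := (al + be * x) * (sin (th + w * x)) * w^-1 + be / w ^+ 2 * cos (th + w * x).
have dF x : is_derive x 1 F ((al + be * x) * cos (th + w * x)).
  have h1 := is_deriveM (is_derive_affine al be x) (is_derive_sin_affine th w x).
  have h2 := is_deriveD (is_deriveZ w^-1 h1) (is_deriveZ (be / w ^+ 2) (is_derive_cos_affine th w
    x)).
  have -> : F = w^-1 *: ((fun y => al + be * y) * (fun y => sin (th + w * y))) +
      (be / w ^+ 2) *: (fun y => cos (th + w * y)).
    by apply/funext => y; rewrite /F mulrC.
  by apply: (is_derive_eq h2); rewrite /GRing.scale /= /GRing.scale /=; field.
rewrite (integral_is_derive ab dF); last exact: continuous_affine_cos.
by rewrite /F; congr (_ %:E); field.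
Qed.

Lemma continuous_affine (al be : R) : continuous (fun x : R => al + be * x).
Proof.
by apply: derivable_continuous => x; exact: (@ex_derive _ _ _ _ _ _ _ (is_derive_affine al be x)).
Qed.

Lemma integral_affine (al be a b : R) : a < b ->
  (\int[mu]_(x in `[a, b]) (al + be * x)%:E =
   ((al * b + be / 2 * b ^+ 2) - (al * a + be / 2 * a ^+ 2))%:E)%E.
Proof.
move=> ab.
pose F (x : R) := x * (al + be / 2 * x).
have dF x : is_derive x 1 F (al + be * x).
  apply: (is_derive_eq (is_deriveM (is_derive_id x 1) (is_derive_affine al (be / 2) x))).
  by rewrite /GRing.scale /= /GRing.scale /=; field.
rewrite (integral_is_derive ab dF)//; first by rewrite /F; congr (_ %:E); field.
exact: continuous_affine.
Qed.

Definition tent D x := Num.max 0 (D - `|x|).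

(* [tentF D w] is the integral of [tent D x * cos (w * x)]. *)
Definition tentF D w := if w == 0 then D ^+ 2 else 2 * (1 - cos (D * w)) / w ^+ 2.

Lemma tent_ge0 D x : 0 <= tent D x.
Proof. by rewrite le_max lexx. Qed.

Lemma tent_eq0 D x : D <= `|x| -> tent D x = 0.
Proof. by move=> Dx; apply/max_idPl; rewrite subr_le0. Qed.

Lemma continuous_tent D : continuous (tent D).
Proof.
have -> : tent D = fun x => (D - `|x| + `|D - `|x| |) / 2.
  by apply/funext => x; rewrite /tent maxr_absE add0r sub0r normrN.
have cD : continuous (fun x : R => D - `|x|).
  by move=> x; apply: cvgB; [exact: cvg_cst|exact: norm_continuous].
move=> x; apply: cvgM; last exact: cvg_cst.
apply: cvgD; first exact: cD.
by apply: (@continuous_comp _ _ _ (fun x => D - `|x|) Num.norm); [exact: cD|exact: norm_continuous].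
Qed.

Lemma normr_sin_le x : `|sin x| <= `|x|.
Proof.
wlog x0 : x / 0 < x => [h|].
  have [x0|x0|->] := ltgtP x 0; [|exact: h|by rewrite sin0].
  by rewrite -normrN -(normrN x) -sinN; apply: h; rewrite oppr_gt0.
have cs : continuous (@sin R) by exact: continuous_sin.
have [c _] := @MVT R sin cos 0 x x0 (fun y _ => is_derive_sin y) (continuous_subspaceT cs).
rewrite sin0 !subr0 => ->; rewrite normrM ler_piMl// ler_norml.
by rewrite cos_geN1 cos_le1.
Qed.

(** This is [1 - cos x = 2 sin^2 (x/2)] combined with [|sin y| <= |y|]. *)
Lemma one_sub_cos_le x : 1 - cos x <= x ^+ 2 / 2.
Proof.
have -> : cos x = cos (x / 2 + x / 2) by congr cos; field.
have h : sin (x / 2) ^+ 2 <= (x / 2) ^+ 2.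
  by rewrite -real_normK ?num_real// -[leRHS]real_normK ?num_real// lerXn2r ?nnegrE ?normr_ge0
    ?normr_sin_le.
have := cos2Dsin2 (x / 2); rewrite cosD -!expr2.
have -> : x ^+ 2 / 2 = 2 * (x / 2) ^+ 2 by field.
lra.
Qed.

(** With [y = D w], after multiplication by [1 + y^2] the term 1 costs [D^2] by
    [1 - cos y <= y^2 / 2], and the term [y^2] costs [4 D^2] by [1 - cos y <= 2]; hence the 5. *)
Lemma tentF_bound D w : 0 < D -> `|tentF D w| <= 5 * D ^+ 2 / (1 + (D * w) ^+ 2).
Proof.
move=> D0; rewrite ler_pdivlMr; last by rewrite ltr_pwDl// sqr_ge0.
rewrite /tentF; case: eqVneq => [->|w0].
  rewrite ger0_norm ?sqr_ge0// mulr0 expr0n addr0 mulr1.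
  by rewrite ler_peMl ?sqr_ge0// ler1n.
have cos1 := one_sub_cos_le (D * w).
have c1 := cos_le1 (D * w); have c2 := cos_geN1 (D * w).
have w2 : 0 < w ^+ 2 by rewrite lt0r sqr_ge0 andbT expf_neq0.
rewrite ger0_norm; last by rewrite !mulr_ge0 ?invr_ge0 ?sqr_ge0// subr_ge0.
rewrite mulrAC ler_pdivrMr//.
have D2 : 0 < D ^+ 2 by rewrite exprn_gt0.
rewrite exprMn in cos1 *; set y := cos _ in cos1 c1 c2 *.
nra.
Qed.

Lemma tent_cos_patch D c (g : R -> R) :
  (fun x => (tent D (x - c) * g x)%:E) =
  (fun x => (tent D (x - c) * g x)%:E) \_ `[c - D, c + D].
Proof.
apply/funext => x; rewrite patchE; case: ifPn => //.
rewrite notin_setE /= in_itv /= => /negP; rewrite -ler_distlC -ltNge distrC => h.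
by rewrite tent_eq0 ?mul0r// ltW.
Qed.

Lemma continuous_tent_cos D c th w : continuous (fun x => tent D (x - c) * cos (th + w * x)).
Proof.
move=> x; apply: cvgM.
  apply: (@continuous_comp _ _ _ (fun x => x - c) (tent D)); last exact: continuous_tent.
  by apply: cvgB; [exact: cvg_id|exact: cvg_cst].
have := @continuous_affine_cos 1 0 th w x.
by under eq_fun do rewrite mul0r addr0 mul1r.
Qed.

Lemma integrable_tent_cos D c th w : 
  mu.-integrable setT (fun x => (tent D (x - c) * cos (th + w * x))%:E).
Proof.
rewrite tent_cos_patch; apply/integrable_restrict => //; rewrite setTI.
apply: (@continuous_compact_integrable _ (fun x => tent D (x - c) * cos (th + w * x))).
  exact: segment_compact.
by apply: continuous_subspaceT; exact: continuous_tent_cos.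
Qed.

Lemma integral_tent_cos D c th w : 0 < D ->
  (\int[mu]_x (tent D (x - c) * cos (th + w * x))%:E =
   (cos (th + w * c) * tentF D w)%:E)%E.
Proof.
move=> D0; rewrite tent_cos_patch -integral_mkcond.
(* The integral is split at the vertex [c]; on each side the tent is affine. *)
rewrite (@itv_bndbnd_setU _ _ _ (BRight c)); last 2 first.
- by rewrite bnd_simp lerBlDr lerDl ltW.
- by rewrite bnd_simp lerDl ltW.
rewrite integral_setU//; last 2 first.
- apply/measurable_EFinP; apply: measurable_funTS.
  by apply: continuous_measurable_fun; exact: continuous_tent_cos.
- apply/disj_set2P; rewrite -subset0 => z/=; rewrite !in_itv/= => -[/andP[_ h]].
  by rewrite ltNge h.
rewrite integral_itv_obnd_cbnd; last first.
  apply/measurable_EFinP; apply: measurable_funTS.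
  by apply: continuous_measurable_fun; exact: continuous_tent_cos.
rewrite (@eq_integral _ _ _ mu `[c - D, c] (fun x => ((D - c + 1 * x) * cos (th + w * x))%:E));
  last first.
  move=> x; rewrite inE /= in_itv /= => /andP[h1 h2].
  congr (_ * _)%:E; rewrite /tent (max_idPr _).
    by rewrite ler0_norm ?subr_le0//; ring.
  by rewrite ler0_norm ?subr_le0//; lra.
rewrite (@eq_integral _ _ _ mu `[c, c + D] (fun x => ((D + c + (-1) * x) * cos (th + w *
  x))%:E)); last first.
  move=> x; rewrite inE /= in_itv /= => /andP[h1 h2].
  congr (_ * _)%:E; rewrite /tent (max_idPr _).
    by rewrite ger0_norm ?subr_ge0//; ring.
  by rewrite ger0_norm ?subr_ge0//; lra.
(* The antiderivative for [w != 0] divides by [w], so frequency 0 is computed directly. *)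
rewrite /tentF; case: eqVneq => [->|w0].
  under eq_integral do rewrite mul0r addr0 mulrC EFinM.
  under [X in (_ + X)%E]eq_integral do rewrite mul0r addr0 mulrC EFinM.
  rewrite !integralZl//; last 2 first.
  - by apply: (@continuous_compact_integrable _ (fun x => D + c + -1 * x)); [exact:
    segment_compact|apply: continuous_subspaceT; exact: continuous_affine].
  - by apply: (@continuous_compact_integrable _ (fun x => D - c + 1 * x)); [exact:
    segment_compact|apply: continuous_subspaceT; exact: continuous_affine].
  rewrite !integral_affine; [|by rewrite ltrDl|by rewrite ltrBlDr ltrDl].
  by rewrite -!EFinM -EFinD mul0r addr0; congr (_ %:E); field.
rewrite !integral_affine_cos//; [|by rewrite ltrDl|by rewrite ltrBlDr ltrDl].
rewrite -EFinD; congr (_ %:E).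
have -> : th + w * (c + D) = (th + w * c) + D * w by ring.
have -> : th + w * (c - D) = (th + w * c) - D * w by ring.
set y := th + w * c; by rewrite !(cosD y) cosN sinN; field.
Qed.

Lemma integral_tent_cos2 D c b1 th1 w1 b2 th2 w2 : 0 < D ->
  (\int[mu]_x (b1 * (tent D (x - c) * cos (th1 + w1 * x)) +
                b2 * (tent D (x - c) * cos (th2 + w2 * x)))%:E =
   (b1 * (cos (th1 + w1 * c) * tentF D w1) + b2 * (cos (th2 + w2 * c) * tentF D w2))%:E)%E.
Proof.
move=> D0.
have i1 := @integrable_tent_cos D c th1 w1.
have i2 := @integrable_tent_cos D c th2 w2.
have ib1 := integrableZl measurableT b1 i1.
have ib2 := integrableZl measurableT b2 i2.
rewrite (@integralD_EFin _ _ _ mu setT measurableT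
  (fun x => b1 * (tent D (x - c) * cos (th1 + w1 * x)))
  (fun x => b2 * (tent D (x - c) * cos (th2 + w2 * x))))//.
have z1 := integralZl measurableT i1 b1.
have z2 := integralZl measurableT i2 b2.
move: z1 z2; rewrite !integral_tent_cos// => z1 z2.
by rewrite [RHS]EFinD; congr (_ + _)%E; [exact: z1|exact: z2].
Qed.

(** Two waves are treated together because a modulated tent times [cos (u, t)] or [sin (u, t)] is a
    sum of two waves, and this avoids splitting a signed [iint]. In the induction the first
    coordinate enters the phases and amplitudes. *)
Lemma iint_tent_cos2 m D (c : 'rV[R]_m) b1 th1 (w1 : 'rV[R]_m) b2 th2 (w2 : 'rV[R]_m) :
  0 < D ->
  iint (fun t => ((\prod_i tent D (t 0 i - c 0 i)) *
     (b1 * cos (th1 + dotR w1 t) + b2 * cos (th2 + dotR w2 t)))%:E) =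
  (b1 * cos (th1 + dotR w1 c) * (\prod_i tentF D (w1 0 i)) +
   b2 * cos (th2 + dotR w2 c) * (\prod_i tentF D (w2 0 i)))%:E.
Proof.
move=> D0; elim: m c b1 th1 w1 b2 th2 w2 => [|m IH] c b1 th1 w1 b2 th2 w2.
  by rewrite /= /dotR !big_ord0 !mul1r !mulr1.
rewrite iintS.
pose tl (w : 'rV[R]_m.+1) : 'rV[R]_m := \row_i w 0 (lift ord0 i).
have tlE (v : 'rV[R]_m.+1) : v = rowcons (v 0 ord0) (tl v).
  apply/rowP => i; case: (unliftP ord0 i) => [j ->|->]; rewrite ?rowcons0 ?rowconsS//.
  by rewrite mxE.
pose B (w : 'rV[R]_m.+1) b th := b * \prod_i tentF D (tl w 0 i).
(* Integrating out the other coordinates replaces them by those of [c] in the phase and leaves their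
   [tentF] factors in the amplitude [B]. *)
transitivity (\int[mu]_x (
   (B w1 b1 th1) * (tent D (x - c 0 ord0) * cos ((th1 + dotR (tl w1) (tl c)) + w1 0 ord0 * x)) +
   (B w2 b2 th2) * (tent D (x - c 0 ord0) * cos ((th2 + dotR (tl w2) (tl c)) + w2 0 ord0 *
     x)))%:E)%E.
  apply: eq_integral => x _.
  rewrite [LHS](_ : _ = iint (fun y => ((\prod_i tent D (y 0 i - tl c 0 i)) *
     ((tent D (x - c 0 ord0) * b1) * cos ((th1 + w1 0 ord0 * x) + dotR (tl w1) y) +
      (tent D (x - c 0 ord0) * b2) * cos ((th2 + w2 0 ord0 * x) + dotR (tl w2) y)))%:E)); last
        first.
    apply: eq_iint => y; congr (_ %:E).
    rewrite (prod_rowcons (fun i z => tent D (z - c 0 i))) !dotR_rowcons !addrA.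
    under [in RHS]eq_bigr do rewrite mxE.
    by ring.
  rewrite IH; congr (_ %:E); rewrite /B !(addrAC _ (_ * x)).
  by ring.
rewrite integral_tent_cos2//; congr (_ %:E).
have dE (v : 'rV[R]_m.+1) : dotR v c = dotR (tl v) (tl c) + v 0 ord0 * c 0 ord0.
  by rewrite {1}(tlE c) dotR_rowcons addrC.
have pE (v : 'rV[R]_m.+1) : \prod_i tentF D (v 0 i) = tentF D (v 0 ord0) * \prod_i tentF D (tl v
  0 i).
  by rewrite big_ord_recl; congr (_ * _); apply: eq_bigr => i _; rewrite mxE.
rewrite /B !dE !pE !addrA.
by ring.
Qed.

End tent.

(** * Lorentzian majorants *)

Section kernel.
Variable R : realType.
Implicit Types (D k u v x y : R).
Local Notation mu := (@lebesgue_measure R).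

(** A Lorentzian centred at [k / D]. The 15 is the 5 of [tentF_bound] times the 3 lost in
    [lorentz_shift]. *)
Definition lorentz D k u := 15 * D ^+ 2 / (1 + (D * u - k) ^+ 2).

Lemma one_add_sqr_gt0 x : 0 < 1 + x ^+ 2.
Proof. by rewrite ltr_pwDl// sqr_ge0. Qed.

Lemma lorentz_ge0 D k u : 0 <= lorentz D k u.
Proof. by apply: divr_ge0; [have := sqr_ge0 D; lra|exact/ltW/one_add_sqr_gt0]. Qed.

(** With [a = D (u - v)] and [|b| <= 1], one has [1 + (a + b)^2 <= 1 + 2 a^2 + 2 b^2 <= 3 (1 +
    a^2)]. *)
Lemma lorentz_shift D k u v : `|D * v - k| <= 1 ->
  5 * D ^+ 2 / (1 + (D * (u - v)) ^+ 2) <= lorentz D k u.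
Proof.
move=> h; rewrite /lorentz ler_pdivrMr ?one_add_sqr_gt0// mulrAC ler_pdivlMr ?one_add_sqr_gt0//.
have h2 : (D * v - k) ^+ 2 <= 1.
  by rewrite -real_normK ?num_real// expr_le1.
rewrite (_ : 15 * D ^+ 2 = (5 * D ^+ 2) * 3); last by ring.
rewrite -[leRHS]mulrA; apply: ler_wpM2l; first by have := sqr_ge0 D; lra.
rewrite (_ : D * u - k = D * (u - v) + (D * v - k)); last by ring.
set a := D * (u - v); set b := D * v - k in h2 *.
have : 0 <= (a - b) ^+ 2 by exact: sqr_ge0.
nra.
Qed.

Lemma continuous_lorentz D k : continuous (lorentz D k).
Proof.
move=> x; apply: cvgM; first exact: cvg_cst.
apply: cvgV; first by rewrite gt_eqF// one_add_sqr_gt0.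
apply: cvgD; first exact: cvg_cst.
have h : (fun u => D * u - k) u @[u --> x] --> D * x - k.
  by apply: cvgB; [apply: cvgMr; exact: cvg_id|exact: cvg_cst].
by apply: (cvgM h h).
Qed.

Lemma integral_lorentz_le D k : 0 < D ->
  (\int[mu]_u (lorentz D k u)%:E <= (15 * D * pi)%:E)%E.
Proof.
move=> D0.
have mk : measurable_fun setT (lorentz D k).
  by apply: continuous_measurable_fun; exact: continuous_lorentz.
(* The line is exhausted by these intervals; on each, the antiderivative [15 D atan (D u - k)]
   varies by at most [15 D pi]. *)
pose F n : set R := `[- n%:R, n%:R]%classic.
have ub : \bigcup_n F n = [set: R].
  apply/seteqP; split => // x _; exists (Num.truncn `|x|).+1 => //=.
  rewrite /F /= in_itv /= -ler_norml; apply: ltW; exact: truncnS_gt.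
have h : (\int[mu]_(x in F i) (lorentz D k x)%:E @[i --> \oo] -->
    \int[mu]_(x in \bigcup_i F i) (lorentz D k x)%:E)%E.
  apply: ge0_nondecreasing_set_cvg_integral.
  - move=> m n mn; apply/subsetPset => x; rewrite /F /= !in_itv /= => /andP[h1 h2].
    by rewrite (le_trans _ h1) ?lerN2 ?ler_nat//= (le_trans h2) ?ler_nat.
  - by move=> n; exact: measurable_itv.
  - by move=> n; apply/measurable_EFinP; exact: measurable_funTS.
  - by move=> n x _; rewrite lee_fin lorentz_ge0.
rewrite -[X in (integral _ X _ <= _)%E]ub -(cvg_lim _ h)//.
apply: lime_le; first by apply/cvg_ex; eexists; exact: h.
near=> n.
have n0 : - n%:R < n%:R :> R by rewrite gtrN// ltr0n; near: n; exists 1%N.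
have dF x : is_derive x (1 : R) (fun y => 15 * D * atan (- k + D * y)) (lorentz D k x).
  have h1 := @is_derive1_comp _ atan (fun y => - k + D * y) x _ _ (is_derive1_atan (- k + D * x))
    (is_derive_affine (- k) D x).
  apply: (is_derive_eq (is_deriveZ (15 * D) h1)).
  rewrite /GRing.scale /= /lorentz (addrC (- k)); field.
  by rewrite gt_eqF// one_add_sqr_gt0.
rewrite /F (integral_is_derive n0 dF); last exact: continuous_lorentz.
rewrite lee_fin -mulrBr ler_pM2l ?mulr_gt0//.
have := atan_ltpi2 (- k + D * n%:R); have := atan_gtNpi2 (- k + D * - n%:R).
lra.
Unshelve. all: by end_near. Qed.

(* [y / (1 + |y|)] is bounded, so summing over integer shifts bounds
   [sum_inv_oneDsqr_le] by telescoping. *)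
Lemma inv_oneDsqr_telescope y :
  (1 + y ^+ 2)^-1 <= 4 * (y / (1 + `|y|)) - 4 * ((y - 1) / (1 + `|y - 1|)).
Proof.
have pos (a : R) : 0 <= a -> 1 + a != 0 by move=> a0; rewrite gt_eqF// ltr_pwDl.
rewrite -[leLHS]mul1r ler_pdivrMr ?one_add_sqr_gt0//.
have [y1|y1] := leP 1 y.
  rewrite !ger0_norm ?subr_ge0//; last exact: le_trans y1.
  have -> : 4 * (y / (1 + y)) - 4 * ((y - 1) / (1 + (y - 1))) = 4 / ((1 + y) * y).
    rewrite (_ : 1 + (y - 1) = y); last by ring.
    by field; rewrite ?andbT; apply/andP; split; rewrite gt_eqF//; lra.
  rewrite mulrAC ler_pdivlMr; last by rewrite mulr_gt0//; lra.
  nra.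
have [y0|y0] := leP y 0.
  rewrite !ler0_norm//; last lra.
  have -> : 4 * (y / (1 - y)) - 4 * ((y - 1) / (1 - (y - 1))) = 4 / ((1 - y) * (2 - y)).
    by field; apply/andP; split; rewrite gt_eqF//; lra.
  rewrite mulrAC ler_pdivlMr; last by rewrite mulr_gt0//; lra.
  have := sqr_ge0 (2 * y + 1); nra.
rewrite (ger0_norm (ltW y0)) ler0_norm; last lra.
have -> : 4 * (y / (1 + y)) - 4 * ((y - 1) / (1 - (y - 1))) =
    4 * (1 + 2 * y * (1 - y)) / ((1 + y) * (2 - y)).
  by field; apply/andP; split; rewrite gt_eqF//; lra.
rewrite mulrAC ler_pdivlMr; last by rewrite mulr_gt0//; lra.
have p1 : 0 <= y * (1 - y) by rewrite mulr_ge0//; lra.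
have p2 : 0 <= (y * (1 - y)) * y ^+ 2 by rewrite mulr_ge0// sqr_ge0.
have p3 := sqr_ge0 y.
have p4 : y * (1 - y) <= 1 by have := sqr_ge0 (2 * y - 1); nra.
nra.
Qed.

Lemma sum_inv_oneDsqr_le n x : \sum_(j < n) (1 + (x - j%:R) ^+ 2)^-1 <= 8.
Proof.
(* The sum telescopes to a difference of two values of [Phi], each at most 4 in absolute value. *)
pose Phi (y : R) := 4 * (y / (1 + `|y|)).
have PhiB y : `|Phi y| <= 4.
  rewrite /Phi normrM (ger0_norm (_ : 0 <= 4))// ler_piMr//.
  rewrite normrM normfV (ger0_norm (_ : 0 <= 1 + `|y|)) ?addr_ge0//.
  by rewrite ler_pdivrMr ?ltr_pwDl// mul1r lerDr.
have h : \sum_(j < n) (1 + (x - j%:R) ^+ 2)^-1 <= Phi x - Phi (x - n%:R).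
  elim: n => [|n IH]; first by rewrite big_ord0 subr0 subrr.
  rewrite big_ord_recr /=; apply: (le_trans (lerD IH (inv_oneDsqr_telescope _))).
  rewrite (_ : x - n.+1%:R = x - n%:R - 1); last by rewrite -natr1; ring.
  by rewrite -/(Phi (x - n%:R)) -/(Phi (x - n%:R - 1)); lra.
have := PhiB x; have := PhiB (x - n%:R); rewrite !ler_norml => /andP[h1 h2] /andP[h3 h4].
lra.
Qed.

(** Distributivity turns the sum over the grid into a product of one-dimensional sums, each at most
    [15 D^2 * 8], whatever the size [n] of the grid. The sign [s] allows for centres at the lattice
    points or at their negatives. *)
Lemma sum_prod_lorentz_le m n (N : R) D (s : R) (u : 'rV[R]_m) : s ^+ 2 = 1 ->
  \sum_(k : {ffun 'I_m -> 'I_n}) \prod_i lorentz D (s * ((k i)%:R - N)) (u 0 i) <=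
  (120 * D ^+ 2) ^+ m.
Proof.
move=> s1.
rewrite -(bigA_distr_bigA (fun i (j : 'I_n) => lorentz D (s * (j%:R - N)) (u 0 i))).
rewrite -[in leRHS](card_ord m) -prodr_const; apply: ler_prod => i _.
apply/andP; split; first by apply: sumr_ge0 => j _; exact: lorentz_ge0.
rewrite /lorentz -mulr_sumr (_ : 120 * D ^+ 2 = 15 * D ^+ 2 * 8); last by ring.
apply: ler_wpM2l; first by have := sqr_ge0 D; lra.
apply: (le_trans _ (sum_inv_oneDsqr_le n (s * (D * u 0 i) + N))).
apply: ler_sum => j _; rewrite (_ : (D * u 0 i - _) ^+ 2 = (s * (D * u 0 i) + N - j%:R) ^+ 2)//.
rewrite (_ : s * _ + N - _ = s * (D * u 0 i - s * (j%:R - N)) + (s ^+ 2 - 1) * (j%:R - N)); last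
  by ring.
by rewrite s1 subrr mul0r addr0 exprMn s1 mul1r.
Qed.

End kernel.

(** * Lebesgue outer measure *)

Section outer.
Variable R : realType.
Implicit Types m n : nat.
Local Open Scope ereal_scope.

Lemma rvol_ge0 m (a b : 'rV[R]_m) : (forall i, a 0%R i <= b 0%R i)%R -> (0 <= rvol a b)%R.
Proof. by move=> ab; apply: prodr_ge0 => i _; rewrite subr_ge0. Qed.

(** The set [S n] is covered with total volume at most [e / 2^(n+1)], and the boxes of all these
    covers are enumerated by pairs of naturals. *)
Lemma leb_outer_bigcup_null m (S : nat -> set 'rV[R]_m) :
  (forall n, leb_outer (S n) <= 0) -> leb_outer (\bigcup_n S n) <= 0.
Proof.
move=> S0; apply/lee_addgt0Pr => e e0; rewrite add0e.
pose P n (ab : (nat -> 'rV[R]_m) * (nat -> 'rV[R]_m)) :=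
  [/\ (forall k i, ab.1 k 0%R i <= ab.2 k 0%R i)%R,
      S n `<=` \bigcup_k rbox (ab.1 k) (ab.2 k) &
      \sum_(0 <= k <oo) (rvol (ab.1 k) (ab.2 k))%:E <= (e / (2 ^ n.+1)%:R)%:E].
have [G PG] : {G : nat -> (nat -> 'rV[R]_m) * (nat -> 'rV[R]_m) & forall n, P n (G n)}.
  apply: (@choice _ _ P) => n.
  have : leb_outer (S n) < (e / (2 ^ n.+1)%:R)%:E.
    by apply: (le_lt_trans (S0 n)); rewrite lte_fin divr_gt0// ltr0n expn_gt0.
  by move=> /ereal_inf_lt[_ [ab [ab1 ab2] <-] /ltW h]; exists ab; split.
pose a (p : nat * nat) := (rvol ((G p.1).1 p.2) ((G p.1).2 p.2))%:E.
have a0 p : 0 <= a p by rewrite lee_fin rvol_ge0//; case: (PG p.1) => h _ _ i; exact: h.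
apply: (@le_trans _ _ (\esum_(p in setT) a p)).
  have /card_esym/ppcard_eqP[f] := card_nat2.
  apply: ereal_inf_lbound => /=.
  exists ((fun k => (G (f k).1).1 (f k).2), (fun k => (G (f k).1).2 (f k).2)).
    split => [k i|]; first by case: (PG (f k).1) => h _ _; exact: h.
    move=> t [n _ Snt]; case: (PG n) => _ /(_ _ Snt)[j _ hj] _.
    by exists (f^-1%FUN (n, j)) => //=; rewrite invK ?inE.
  rewrite /= -(esum_pred_image a f xpredT) ?[fun=> _]set_true//.
  by rewrite image_eq.
(* The terms are nonnegative, so the unordered sum over pairs is an iterated series. *)
rewrite (_ : esum _ _ = \sum_(0 <= n <oo) \sum_(0 <= j <oo) a (n, j)); last first.
  rewrite nneseries_esumT; last by move=> n; apply: nneseries_ge0 => j _ _; exact: a0.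
  under [RHS]eq_esum do rewrite nneseries_esumT//.
  rewrite (@esum_esum _ _ _ setT (fun=> setT) (fun i j => a (i, j)))//.
  rewrite (_ : setT `*`` _ = setT); last by apply/seteqP; split.
  by apply: eq_esum => -[].
apply: (@le_trans _ _ (\sum_(0 <= n <oo) (0 + (e / (2 ^ n.+1)%:R)%:E))).
  apply: lee_nneseries => [n _ _|n _]; first by apply: nneseries_ge0 => j _ _; exact: a0.
  by rewrite add0e; case: (PG n).
apply: (le_trans (epsilon_trick xpredT _ (ltW e0))) => //.
by rewrite eseries0// add0e.
Qed.

Lemma exists_leb_outer_gt0 m (S : nat -> set 'rV[R]_m) :
  0 < leb_outer (\bigcup_n S n) -> exists n, 0 < leb_outer (S n).
Proof.
move=> S0; apply: contrapT => /forallNP h.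
have : leb_outer (\bigcup_n S n) <= 0.
  by apply: leb_outer_bigcup_null => n; rewrite leNgt; apply/negP.
by rewrite leNgt S0.
Qed.

(** The finite list is continued by the box [(0, 0)]. In dimension [m.+1] its volume is a nonempty
    product of zeros, so the padding costs nothing. *)
Lemma leb_outer_le_sum m (s : seq ('rV[R]_m.+1 * 'rV[R]_m.+1)) S :
  (forall ab, ab \in s -> forall i, ab.1 0%R i <= ab.2 0%R i)%R ->
  (forall t, S t -> exists2 ab, ab \in s & rbox ab.1 ab.2 t) ->
  leb_outer S <= (\sum_(ab <- s) rvol ab.1 ab.2)%:E.
Proof.
move=> sle sS; apply: ereal_inf_lbound => /=.
exists ((fun k => (nth (0, 0)%R s k).1), (fun k => (nth (0, 0)%R s k).2)).
  split => [k i|t /sS[ab abs tab]] /=.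
    have [ks|ks] := ltnP k (size s); first by apply: sle; exact: mem_nth.
    by rewrite nth_default.
  by exists (index ab s) => //; rewrite nth_index.
rewrite (nneseries_split 0 (size s)); last first.
  move=> k _; rewrite lee_fin rvol_ge0// => i /=.
  have [ks|ks] := ltnP k (size s); first by apply: sle; exact: mem_nth.
  by rewrite nth_default.
rewrite [X in _ + X]eseries0 ?adde0; last first.
  move=> k ks _ /=; rewrite nth_default//= /rvol big_ord_recl /= subrr mul0r//.
by rewrite add0n sumEFin (big_nth (0, 0)%R).
Qed.

Lemma leb_outer_grid m n (H : {set {ffun 'I_m.+1 -> 'I_n}}) (N h : R)
    (S : set 'rV[R]_m.+1) : (0 <= h)%R ->
  (forall t, S t -> exists2 k : {ffun 'I_m.+1 -> 'I_n}, k \in H &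
     forall i, (h * ((k i)%:R - N) <= t 0%R i < h * ((k i)%:R - N) + h)%R) ->
  leb_outer S <= (#|H|%:R * h ^+ m.+1)%:E.
Proof.
move=> h0 hS.
pose lo (k : {ffun 'I_m.+1 -> 'I_n}) : 'rV[R]_m.+1 := (\row_i (h * ((k i)%:R - N)))%R.
pose hi (k : {ffun 'I_m.+1 -> 'I_n}) : 'rV[R]_m.+1 := (\row_i (h * ((k i)%:R - N) + h))%R.
apply: (le_trans (@leb_outer_le_sum _ [seq (lo k, hi k) | k <- enum H] S _ _)).
- by move=> _ /mapP[k _ ->] i; rewrite !mxE lerDl.
- move=> t /hS[k kH kt]; exists (lo k, hi k); first by apply: map_f; rewrite mem_enum.
  by move=> i; rewrite !mxE.
- rewrite big_map /= big_enum /= (eq_bigr (fun=> h ^+ m.+1)%R).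
    by rewrite sumr_const mulr_natl.
  move=> k _; rewrite /rvol -[in RHS](card_ord m.+1) -prodr_const.
  by apply: eq_bigr => i _; rewrite !mxE addrAC subrr add0r.
Qed.

End outer.

(** * First-order Taylor estimate *)

Section first_order.
Variable R : realType.
Implicit Types m : nat.

Lemma derive_line m (phi : 'rV[R]_m -> R) (z e : 'rV[R]_m) (x : R) :
  derivable phi (z + x *: e) e ->
  is_derive x (1 : R) (fun y : R => phi (z + y *: e)) ('D_e phi (z + x *: e)).
Proof.
move=> d.
have E : (fun h : R => h^-1 *: (((fun y : R => phi (z + y *: e)) \o shift x) (h *: (1 : R)) - phi
  (z + x *: e))) =
    (fun h : R => h^-1 *: ((phi \o shift (z + x *: e)) (h *: e) - phi (z + x *: e))).
  apply/funext => h /=; congr (_ *: (phi _ - _)).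
  rewrite (_ : h *: (1 : R) = h); last by rewrite /GRing.scale /= mulr1.
  by rewrite scalerDl addrCA.
by split; [rewrite /derivable E|rewrite /derive E].
Qed.

(** The conditions [|x| <= |r|] and [0 <= x * r] place [x] between 0 and [r] for either sign of
    [r]. *)
Lemma mvt_line m (phi : 'rV[R]_m -> R) (z e : 'rV[R]_m) (r : R) :
  (forall x, `|x| <= `|r| -> 0 <= x * r -> derivable phi (z + x *: e) e) ->
  exists2 x, `|x| <= `|r| /\ 0 <= x * r &
    phi (z + r *: e) - phi z = 'D_e phi (z + x *: e) * r.
Proof.
move=> d; pose f (y : R) := phi (z + y *: e).
have f0 : phi z = f 0 by rewrite /f scale0r addr0.
rewrite f0 -/(f r).
have [r0|r0] := leP 0 r.
  have d' x : x \in `[0, r] -> derivable phi (z + x *: e) e.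
    rewrite in_itv /= => /andP[x0 xr]; apply: d; last exact: mulr_ge0.
    by rewrite !ger0_norm.
  have [|c cI ->] := @MVT_segment R f (fun y => 'D_e phi (z + y *: e)) 0 r r0
    (fun x xI => derive_line (d' x (subset_itv_oo_cc xI))).
    apply: derivable_within_continuous => x xI.
    exact: (@ex_derive _ _ _ _ _ _ _ (derive_line (d' x xI))).
  exists c; last by rewrite subr0.
  by move: cI; rewrite in_itv /= => /andP[c0 cr]; rewrite !ger0_norm// mulr_ge0.
have d' x : x \in `[r, 0] -> derivable phi (z + x *: e) e.
  rewrite in_itv /= => /andP[x0 xr]; apply: d; last by rewrite mulr_le0// ltW.
  by rewrite !ler0_norm ?lerN2// ltW.
have [|c cI E] := @MVT_segment R f (fun y => 'D_e phi (z + y *: e)) r 0 (ltW r0)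
  (fun x xI => derive_line (d' x (subset_itv_oo_cc xI))).
  apply: derivable_within_continuous => x xI.
  exact: (@ex_derive _ _ _ _ _ _ _ (derive_line (d' x xI))).
exists c; last by rewrite -opprB E sub0r mulrN opprK.
by move: cI; rewrite in_itv /= => /andP[c0 cr]; rewrite !ler0_norm ?lerN2 ?(ltW r0)// mulr_le0//
  ltW.
Qed.

(** The point moves from [t] to [s] one coordinate at a time. By the mean value theorem each move
    differs from its linear prediction at [t] by at most [M * D]. *)
Lemma first_order_bound m (phi : 'rV[R]_m -> R) (t s : 'rV[R]_m) (D M : R) :
  (forall (z : 'rV[R]_m) (k : 'I_m), (forall i, `|z 0 i - t 0 i| <= D) -> derivable phi z
    (unit_vec R k)) ->
  (forall (z : 'rV[R]_m) (k : 'I_m), (forall i, `|z 0 i - t 0 i| <= D) ->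
     `|partial k phi z - partial k phi t| <= M) ->
  (forall i, `|s 0 i - t 0 i| <= D) ->
  `|phi s - phi t - dotR (grad phi t) (s - t)| <= m%:R * (M * D).
Proof.
move=> dphi Mphi sD.
(* The intermediate point [z j] has its first [j] coordinates from [s] and the others from [t], so
   it stays in the cube around [t]. *)
pose z (j : nat) : 'rV[R]_m := \row_i (if (i < j)%N then s 0 i else t 0 i).
have z0 : z 0%N = t by apply/rowP => i; rewrite mxE.
have zm : z m = s by apply/rowP => i; rewrite mxE ltn_ord.
have zS (j : 'I_m) : z j.+1 = z j + (s 0 j - t 0 j) *: unit_vec R j.
  apply/rowP => i; rewrite !mxE /= ltnS leq_eqVlt.
  have [->|ij] := eqVneq i j; first by rewrite eqxx ltnn mulr1 addrC subrK.
  by rewrite -(inj_eq val_inj) in ij; rewrite (negbTE ij) mulr0 addr0.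
have step (j : 'I_m) :
    `|phi (z j.+1) - phi (z j) - partial j phi t * (s 0 j - t 0 j)| <= M * D.
  have box x : `|x| <= `|s 0 j - t 0 j| -> 0 <= x * (s 0 j - t 0 j) ->
     forall i, `|(z j + x *: unit_vec R j) 0 i - t 0 i| <= D.
    move=> xr _ i; rewrite !mxE /=.
    have [->|ij] := eqVneq i j.
      by rewrite ltnn mulr1 addrAC subrr add0r (le_trans xr).
    rewrite mulr0 addr0; case: ifPn => _ //.
    by rewrite subrr normr0 (le_trans _ (sD i)).
  have [x [x1 x2] E] := @mvt_line m phi (z j) (unit_vec R j) (s 0 j - t 0 j)
     (fun x h1 h2 => dphi _ j (box x h1 h2)).
  rewrite zS E -mulrBl normrM ler_pM//.
  exact: Mphi (box x x1 x2).
have -> : phi s - phi t = \sum_(j < m) (phi (z j.+1) - phi (z j)).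
  by rewrite -(big_mkord xpredT (fun j => phi (z j.+1) - phi (z j))) telescope_sumr// z0 zm.
rewrite /dotR -sumrB; apply: (le_trans (ler_norm_sum _ _ _)).
rewrite [leRHS](_ : _ = \sum_(j < m) M * D); last by rewrite sumr_const card_ord mulr_natl.
by apply: ler_sum => j _; have := step j; rewrite !mxE.
Qed.

End first_order.

(** * The local lower bound *)

Section local.
Variable R : realType.
Implicit Types m : nat.

(** If [G > e], then [e^(1-p) G^(p-1) >= 1], so the second term alone exceeds [G]. *)
Lemma young_powR (p e G : R) : 1 <= p -> 0 < e -> 0 <= G ->
  G <= e + e `^ (1 - p) * G `^ p.
Proof.
move=> p1 e0 G0; have [Ge|eG] := leP G e.
  by rewrite (le_trans Ge)// lerDl mulr_ge0// powR_ge0.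
have Gp : 0 < G by exact: lt_trans eG.
have -> : G `^ p = G `^ (p - 1) * G.
  have := @powRD _ G (p - 1) 1; rewrite subrK powRr1// (gt_eqF Gp) implybT; exact.
have h : e `^ (p - 1) <= G `^ (p - 1).
  by apply: ge0_ler_powR; rewrite ?nnegrE ?subr_ge0// ltW.
have E : e `^ (1 - p) * e `^ (p - 1) = 1.
  by rewrite -powRD ?(gt_eqF e0) ?implybT// subrKA subrr powRr0.
have : 1 <= e `^ (1 - p) * G `^ (p - 1).
  by rewrite -[leLHS]E ler_wpM2l// powR_ge0.
move=> h1; rewrite mulrA; apply: (@le_trans _ _ (1 * G)); first by rewrite mul1r.
by apply: ler_wpDl; [exact: ltW|rewrite ler_wpM2r].
Qed.

Lemma cos_lipschitz (a eta : R) : `|cos (a + eta) - cos a| <= `|eta|.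
Proof.
have -> : cos (a + eta) - cos a = - (2 * sin (a + eta / 2) * sin (eta / 2)).
  rewrite (_ : a + eta = (a + eta / 2) + eta / 2); last by field.
  rewrite [in X in _ - X](_ : a = (a + eta / 2) - eta / 2); last by ring.
  by set b := a + eta / 2; rewrite (cosD b) (cosB b); ring.
rewrite normrN -mulrA mulrCA normrM.
apply: (@le_trans _ _ (1 * (2 * `|eta / 2|))).
  apply: ler_pM => //; first by rewrite ler_norml sin_geN1 sin_le1.
  by rewrite normrM ger0_norm// ler_pM2l// normr_sin_le.
by rewrite mul1r normrM [`|2^-1|]ger0_norm// mulrC -mulrA mulVf// mulr1.
Qed.

Lemma continuous_coord m (i : 'I_m) : continuous (fun s : 'rV[R]_m => s 0 i).
Proof.
exact: coord_continuous.
Qed.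

Section wave_packet.
Variables (m : nat) (D : R) (t v : 'rV[R]_m).
Hypothesis D0 : 0 < D.

(** The free phase [th] lets the same packet test the real or the imaginary part of the
    exponential. *)
Definition packet (th : R) (s : 'rV[R]_m) : R :=
  (\prod_i tent D (s 0 i - t 0 i)) * cos (th + dotR v s).

Lemma packet_eq0 th (s : 'rV[R]_m) i : D <= `|s 0 i - t 0 i| -> packet th s = 0.
Proof.
by move=> h; rewrite /packet (bigD1 i)//= tent_eq0// !mul0r.
Qed.

Lemma continuous_dotR : continuous (dotR v).
Proof.
rewrite /dotR; apply: continuous_big => [|i _]; first by move=> x; exact: add_continuous.
move=> s; apply: (@cvgMr R _ (nbhs s)).
exact: continuous_coord.
Qed.

Lemma continuous_packet th : continuous (packet th).
Proof.
have c1 : continuous (fun s : 'rV[R]_m => \prod_i tent D (s 0 i - t 0 i)).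
  apply: continuous_big => [|i _]; first by move=> x; exact: mul_continuous.
  move=> s; apply: (@continuous_comp _ _ _ (fun s : 'rV[R]_m => s 0 i) (fun x => tent D (x - t 0
    i))).
    exact: continuous_coord.
  apply: (@continuous_comp _ _ _ (fun x => x - t 0 i) (tent D)); last exact: continuous_tent.
  by apply: cvgB; [exact: cvg_id|exact: cvg_cst].
have c2 : continuous (fun s => cos (th + dotR v s)).
  move=> s; apply: (@continuous_comp _ _ _ (dotR v) (fun x => cos (th + x))).
    exact: continuous_dotR.
  apply: (@continuous_comp _ _ _ (fun x => th + x) cos); last exact: continuous_cos.
  by apply: cvgD; [exact: cvg_cst|exact: cvg_id].
move=> s; apply: (@cvgM R _ (nbhs s) _ (fun s => \prod_i tent D (s 0 i - t 0 i))
  (fun s => cos (th + dotR v s))); [exact: c1|exact: c2].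
Qed.

Lemma test_fun_packet V th : (forall s : 'rV[R]_m, (forall i, `|s 0 i - t 0 i| <= D) -> V s) ->
  test_fun V (packet th).
Proof.
move=> boxV; split; first exact: continuous_packet.
exists [set s : 'rV[R]_m | forall i, `[t 0 i - D, t 0 i + D]%classic (s ord0 i)]; split.
- apply: (@rV_compact R m (fun i => `[t 0 i - D, t 0 i + D]%classic)) => i.
  exact: segment_compact.
- move=> s /= sbox; apply: boxV => i.
  by have := sbox i; rewrite /= in_itv /= -ler_distlC distrC.
- move=> s /= /existsNP[i /=]; rewrite in_itv /= => /negP.
  rewrite -ler_distlC -ltNge distrC => h.
  by apply: (@packet_eq0 _ _ i); exact: ltW.
Qed.

(** Two centres, because a real cosine carries both frequencies [v] and [- v]. *)
Definition lorentz2 (k : 'I_m -> R) (u : 'rV[R]_m) : R :=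
  (\prod_i lorentz D (k i) (u 0 i)) + (\prod_i lorentz D (- k i) (u 0 i)).

Lemma lorentz2_ge0 k u : 0 <= lorentz2 k u.
Proof. by apply: addr_ge0; apply: prodr_ge0 => i _; exact: lorentz_ge0. Qed.

(** The common form of the cosine and sine transforms of a packet after product-to-sum, whose
    coefficients are [1/2] in absolute value. The wave [v - u] is controlled by the centre [k], the
    wave [v + u] by [- k]. *)
Lemma packet_ft_bound (k : 'I_m -> R) (c1 th1 c2 th2 : R) u :
  (forall i, `|D * v 0 i - k i| <= 1) -> `|c1| <= 2^-1 -> `|c2| <= 2^-1 ->
  exists2 r : R, iint (fun s => ((\prod_i tent D (s 0 i - t 0 i)) *
     (c1 * cos (th1 + dotR (v + u) s) + c2 * cos (th2 + dotR (v - u) s)))%:E) = r%:E &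
     `|r| <= 2^-1 * lorentz2 k u.
Proof.
move=> vk hc1 hc2; eexists; first exact: iint_tent_cos2.
have cosB x : `|cos x| <= 1 :> R by rewrite ler_norml cos_geN1 cos_le1.
have key (c x P Q : R) : `|c| <= 2^-1 -> `|P| <= Q -> `|c * cos x * P| <= 2^-1 * Q.
  move=> hc hP; rewrite !normrM ler_pM// ?mulr_ge0//.
  by rewrite -[leRHS]mulr1; apply: ler_pM.
have prodB (w : 'rV[R]_m) (l : 'I_m -> R) :
    (forall i, `|tentF D (w 0 i)| <= lorentz D (l i) (u 0 i)) ->
    `|\prod_i tentF D (w 0 i)| <= \prod_i lorentz D (l i) (u 0 i).
  by move=> h; rewrite normr_prod; apply: ler_prod => i _; rewrite normr_ge0 h.
rewrite /lorentz2 addrC mulrDr; apply: (le_trans (ler_normD _ _)).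
apply: lerD; apply: key => //; apply: prodB => i; apply: (le_trans (tentF_bound _ D0)); rewrite
  !mxE.
- by rewrite -[X in 1 + X]sqrrN -mulrN opprB; exact: lorentz_shift.
- rewrite (_ : v 0 i + u 0 i = u 0 i - (- v 0 i)); last by rewrite opprK addrC.
  by apply: lorentz_shift; rewrite mulrN -opprD normrN.
Qed.

Lemma cosMcos (a b : R) : cos a * cos b = 2^-1 * cos (a + b) + 2^-1 * cos (a - b).
Proof. by rewrite cosD cosB; field. Qed.

(** The sines are written as cosines shifted by [pi / 2], the shape that [packet_ft_bound]
    treats. *)
Lemma cosMsin (a b : R) :
  cos a * sin b = 2^-1 * cos (a + b - pi / 2) + (- 2^-1) * cos (a - b - pi / 2).
Proof.
have h x : cos (x - pi / 2) = sin x :> R by rewrite cosB cos_pihalf sin_pihalf mulr0 add0r mulr1.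
by rewrite !h sinD sinB; field.
Qed.

Lemma dotRDl (a b s : 'rV[R]_m) : dotR (a + b) s = dotR a s + dotR b s.
Proof. by rewrite /dotR -big_split; apply: eq_bigr => i _; rewrite mxE mulrDl. Qed.

Lemma dotRBl (a b s : 'rV[R]_m) : dotR (a - b) s = dotR a s - dotR b s.
Proof. by rewrite /dotR -sumrB; apply: eq_bigr => i _; rewrite !mxE mulrBl. Qed.

Lemma ftc_packet th (k : 'I_m -> R) u : (forall i, `|D * v 0 i - k i| <= 1) ->
  exists2 r : R, ftc (packet th) u = r%:E & `|r| <= 2^-1 * lorentz2 k u.
Proof.
move=> vk.
have [||r E rb] := @packet_ft_bound k 2^-1 th 2^-1 th u vk.
- by rewrite ger0_norm.
- by rewrite ger0_norm.
exists r => //; rewrite -E; apply: eq_iint => s; congr (_ %:E).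
by rewrite /packet -mulrA cosMcos dotRDl dotRBl !addrA.
Qed.

Lemma fts_packet th (k : 'I_m -> R) u : (forall i, `|D * v 0 i - k i| <= 1) ->
  exists2 r : R, fts (packet th) u = r%:E & `|r| <= 2^-1 * lorentz2 k u.
Proof.
move=> vk.
have [||r E rb] := @packet_ft_bound k 2^-1 (th - pi / 2) (- 2^-1) (th - pi / 2) u vk.
- by rewrite ger0_norm.
- by rewrite normrN ger0_norm.
exists r => //; rewrite -E; apply: eq_iint => s; congr (_ %:E).
rewrite /packet -mulrA cosMsin dotRDl dotRBl !addrA.
by rewrite !(addrAC _ (- (pi / 2))).
Qed.

(* [cos (a + eta) * cos a >= cos^2 a - |eta|] and [cos^2 a = (1 + cos (2 a)) / 2] *)
Lemma packet_test_ge (f : 'rV[R]_m -> R) th :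
  (forall s : 'rV[R]_m, (forall i, `|s 0 i - t 0 i| <= D) -> `|f s - (th + dotR v s)| <= 4^-1) ->
  0 <= cos (2 * (th + dotR v t)) * \prod_i tentF D (2 * v 0 i) ->
  ((4^-1 * D ^+ 2 ^+ m)%:E <= iint (fun s => (cos (f s) * packet th s)%:E))%E.
Proof.
move=> hf hs.
(* The minorant [cos^2 a - 1/4 = 1/4 + cos (2 a) / 2] consists of two waves, of frequencies 0 and
   [2 v], so its integral is explicit. *)
have h0 := @iint_tent_cos2 R m D t 4^-1 0 0 2^-1 (2 * th) (2 *: v) D0.
have dot0 s : dotR (0 : 'rV[R]_m) s = 0.
  by rewrite /dotR big1// => i _; rewrite mxE mul0r.
have dotZ s : dotR (2 *: v) s = 2 * dotR v s.
  by rewrite /dotR mulr_sumr; apply: eq_bigr => i _; rewrite mxE mulrA.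
have tF0 : \prod_(i < m) tentF D ((0 : 'rV[R]_m) 0 i) = (D ^+ 2) ^+ m.
  rewrite -[in RHS](card_ord m) -prodr_const; apply: eq_bigr => i _.
  by rewrite mxE /tentF eqxx.
apply: (@le_trans _ _ (iint (fun s => ((\prod_i tent D (s 0 i - t 0 i)) *
     (4^-1 * cos (0 + dotR (0 : 'rV[R]_m) s) + 2^-1 * cos (2 * th + dotR (2 *: v) s)))%:E))).
  rewrite h0 lee_fin dot0 addr0 cos0 mulr1 tF0 lerDl dotZ -mulrDr -mulrA mulr_ge0//.
  by under eq_bigr do rewrite mxE.
apply: le_iint => s; rewrite lee_fin dot0 addr0 cos0 mulr1 dotZ -mulrDr.
have [sbox|/existsNP[i /negP]] := pselect (forall i, `|s 0 i - t 0 i| <= D); last first.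
  rewrite -ltNge => /ltW h.
  by rewrite (packet_eq0 _ h) mulr0 (bigD1 i)//= tent_eq0// !mul0r.
rewrite /packet mulrCA ler_wpM2l//; first by apply: prodr_ge0 => i _; exact: tent_ge0.
have := hf s sbox; set a := th + dotR v s => hfa.
have [eta -> he] : exists2 eta, f s = a + eta & `|eta| <= 4^-1.
  by exists (f s - a); rewrite // addrC subrK.
have cc := cos2Dsin2 a.
rewrite (_ : 2 * a = a + a); last by ring.
have h1 := cos_lipschitz a eta; rewrite cosD -!expr2.
have c1 : `|cos a| <= 1 by rewrite ler_norml cos_geN1 cos_le1.
have h2 : `|(cos (a + eta) - cos a) * cos a| <= 4^-1 * 1.
  by rewrite normrM ler_pM//; apply: (le_trans _ he).
by move: h2; rewrite ler_norml => /andP[h2 _]; lra.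
Qed.

(** Both transforms of the packet are at most half of [lorentz2], and [(|g1| + |g2|) / 2 <= |g|] for
    [g = g1 + i g2]. *)
Lemma packet_pairing_le V (g1 g2 f1 f2 : 'rV[R]_m -> R) th (k : 'I_m -> R) :
  (forall s : 'rV[R]_m, (forall i, `|s 0 i - t 0 i| <= D) -> V s) ->
  (forall i, `|D * v 0 i - k i| <= 1) ->
  ift_eq_on V g1 g2 f1 f2 ->
  (iint (fun s => (f1 s * packet th s)%:E) <=
     iint (fun u => (Num.sqrt (g1 u ^+ 2 + g2 u ^+ 2) * lorentz2 k u)%:E) /\
   iint (fun s => (f2 s * packet th s)%:E) <=
     iint (fun u => (Num.sqrt (g1 u ^+ 2 + g2 u ^+ 2) * lorentz2 k u)%:E))%E.
Proof.
move=> boxV vk /(_ _ (test_fun_packet th boxV))[-> ->].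
have key (a b x y L : R) : `|a| <= 2^-1 * L -> `|b| <= 2^-1 * L ->
    `|x * a + y * b| <= Num.sqrt (x ^+ 2 + y ^+ 2) * L.
  move=> ha hb; apply: (le_trans (ler_normD _ _)); rewrite !normrM.
  have xG : `|x| <= Num.sqrt (x ^+ 2 + y ^+ 2).
    by rewrite -sqrtr_sqr ler_wsqrtr// lerDl sqr_ge0.
  have yG : `|y| <= Num.sqrt (x ^+ 2 + y ^+ 2).
    by rewrite -sqrtr_sqr ler_wsqrtr// lerDr sqr_ge0.
  have h1 := ler_pM (normr_ge0 x) (normr_ge0 a) xG ha.
  have h2 := ler_pM (normr_ge0 y) (normr_ge0 b) yG hb.
  by move: (Num.sqrt _) h1 h2 => g h1 h2; lra.
split; apply: (le_trans (lee_abs _)); apply: (le_trans (abse_iint _)); apply: le_iint => u;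
  have [a -> ha] := @ftc_packet th k u vk; have [b -> hb] := @fts_packet th k u vk.
- by rewrite -!EFinM -EFinB lee_fin -mulNr -(sqrrN (g2 u)); exact: key.
- by rewrite -!EFinM -EFinD lee_fin; exact: key.
Qed.

(* The case distinction makes the oscillating term of [packet_test_ge] nonnegative
   by testing either the real or the imaginary part. *)
Lemma local_lower_bound p (phi : 'rV[R]_m -> R) lambda V (g1 g2 : 'rV[R]_m -> R)
    (k : 'I_m -> R) (e := D ^+ m / (16 * (15 * pi) ^+ m)) :
  1 <= p -> (forall s : 'rV[R]_m, (forall i, `|s 0 i - t 0 i| <= D) -> V s) ->
  (forall s : 'rV[R]_m, (forall i, `|s 0 i - t 0 i| <= D) ->
     `|lambda * phi s - (lambda * phi t + dotR v (s - t))| <= 4^-1) ->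
  (forall i, `|D * v 0 i - k i| <= 1) ->
  ift_eq_on V g1 g2 (fun s => cos (lambda * phi s)) (fun s => sin (lambda * phi s)) ->
  ((8^-1 * D ^+ 2 ^+ m)%:E <= (e `^ (1 - p))%:E *
    iint (fun u => (Num.sqrt (g1 u ^+ 2 + g2 u ^+ 2) `^ p * lorentz2 k u)%:E))%E.
Proof.
move=> p1 boxV lin vk ift; set G := fun u => Num.sqrt (g1 u ^+ 2 + g2 u ^+ 2).
have dotB (s : 'rV[R]_m) : dotR v (s - t) = dotR v s - dotR v t.
  by rewrite /dotR -sumrB; apply: eq_bigr => i _; rewrite !mxE mulrBr.
have A : ((4^-1 * D ^+ 2 ^+ m)%:E <= iint (fun u => (G u * lorentz2 k u)%:E))%E.
  set th := lambda * phi t - dotR v t.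
  have lin0 (s : 'rV[R]_m) : (forall i, `|s 0 i - t 0 i| <= D) ->
      `|lambda * phi s - (th + dotR v s)| <= 4^-1.
    by move=> /lin; rewrite dotB /th; congr (`|_ - _| <= _); ring.
  have [pos|neg] := leP 0 (cos (2 * (th + dotR v t)) * \prod_i tentF D (2 * v 0 i)).
    apply: (le_trans (packet_test_ge lin0 pos)).
    by have [] := packet_pairing_le th boxV vk ift.
  (* Moving the phase by [pi / 2] turns [sin] into [cos] and moves the doubled phase by [pi], which
     reverses the sign of the oscillating term. *)
  pose f s := lambda * phi s - pi / 2.
  have lin1 (s : 'rV[R]_m) : (forall i, `|s 0 i - t 0 i| <= D) ->
      `|f s - (th - pi / 2 + dotR v s)| <= 4^-1.
    by move=> /lin0; rewrite /f; congr (`|_| <= _); ring.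
  have pos : 0 <= cos (2 * (th - pi / 2 + dotR v t)) * \prod_i tentF D (2 * v 0 i).
    rewrite (_ : 2 * _ = 2 * (th + dotR v t) - pi); last by field.
    by rewrite cosB cospi sinpi mulr0 addr0 mulrN1 mulNr oppr_ge0 ltW.
  apply: (le_trans (packet_test_ge lin1 pos)).
  have [_ h] := packet_pairing_le (th - pi / 2) boxV vk ift; apply: le_trans h.
  by apply: le_iint => s; rewrite /f cosB cos_pihalf sin_pihalf mulr0 add0r mulr1.
have pi0 : 0 < pi :> R by exact: pi_gt0.
have e0 : 0 < e by rewrite divr_gt0 ?mulr_gt0 ?exprn_gt0 ?mulr_gt0.
pose P u := G u `^ p.
have P0 u : 0 <= P u by exact: powR_ge0.
have PL0 u : (0 <= (P u * lorentz2 k u)%:E)%E by rewrite lee_fin mulr_ge0// lorentz2_ge0.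
have ep0 : 0 < e `^ (1 - p) by exact: powR_gt0.
have I0 : 0 <= 15 * D * pi by rewrite !mulr_ge0 ?ltW.
have mlor (l : 'I_m -> R) i : measurable_fun setT (lorentz D (l i)).
  by apply: continuous_measurable_fun; exact: continuous_lorentz.
(* Young's inequality under the integral: the constant [e] is multiplied by the two Lorentzian
   products, which are split off one after the other by [iintD_prod_le]. *)
have B : (iint (fun u => (G u * lorentz2 k u)%:E) <=
    (e * (15 * D * pi) ^+ m)%:E + ((e * (15 * D * pi) ^+ m)%:E +
    (e `^ (1 - p))%:E * iint (fun u => (P u * lorentz2 k u)%:E)))%E.
  rewrite -iintZl//.
  have h2 := @iintD_prod_le R m e (15 * D * pi) (fun i => lorentz D (- k i))
    (fun u => (e `^ (1 - p))%:E * (P u * lorentz2 k u)%:E)%E (ltW e0) I0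
    (fun i x => lorentz_ge0 _ _ _) (mlor _) (fun i => integral_lorentz_le _ D0).
  apply: le_trans (leeD2l _ (h2 _)); last first.
    by move=> u; rewrite mule_ge0// lee_fin ltW.
  have h1 := @iintD_prod_le R m e (15 * D * pi) (fun i => lorentz D (k i))
    (fun u => (e * \prod_i lorentz D (- k i) (u 0 i))%:E +
        (e `^ (1 - p))%:E * (P u * lorentz2 k u)%:E)%E (ltW e0) I0
    (fun i x => lorentz_ge0 _ _ _) (mlor _) (fun i => integral_lorentz_le _ D0).
  apply: le_trans (h1 _); last first.
    move=> u; rewrite adde_ge0// ?mule_ge0// ?lee_fin ?(ltW ep0)//.
    by rewrite mulr_ge0 ?(ltW e0)// prodr_ge0// => i _; exact: lorentz_ge0.
  apply: le_iint => u; rewrite -!EFinM -!EFinD lee_fin addrA -mulrDr -/(lorentz2 k u).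
  rewrite mulrA -mulrDl ler_wpM2r ?lorentz2_ge0//.
  by apply: young_powR => //; exact: sqrtr_ge0.
(* The reason for the value of [e]: the two absorbed terms together take half of the [1/4] in [A]
   and leave [1/8]. *)
have eI : e * (15 * D * pi) ^+ m = 16^-1 * D ^+ 2 ^+ m.
  rewrite (_ : 15 * D * pi = D * (15 * pi)); last by ring.
  rewrite /e expr2 (exprMn m D (15 * pi)) (exprMn m D D).
  have : (15 * pi : R) ^+ m != 0 by rewrite expf_neq0// gt_eqF// mulr_gt0.
  by move: ((15 * pi) ^+ m) (D ^+ m) => y x y0; field.
have := le_trans A B; rewrite eI.
have Z0 : (0 <= (e `^ (1 - p))%:E * iint (fun u => (P u * lorentz2 k u)%:E))%E.
  by rewrite mule_ge0 ?lee_fin ?(ltW ep0)// iint_ge0.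
have fin (x : R) (Z : \bar R) : (0 <= Z)%E ->
    ((4^-1 * x)%:E <= (16^-1 * x)%:E + ((16^-1 * x)%:E + Z))%E -> ((8^-1 * x)%:E <= Z)%E.
  by case: Z => [z| |]// _; rewrite ?leey// -!EFinD !lee_fin; lra.
exact: fin.
Qed.

End wave_packet.

End local.

(** * Counting frequencies *)

Section global.
Variable R : realType.

(** Gradient space is cut into cubes of side [1 / (D |lambda|)]. Each cube met by the image
    contributes at least [D^(2m) / 8] by [local_lower_bound], while all of them together give at
    most [2 e^(1-p) (120 D^2)^m r]; the quotient bounds their number. *)
Lemma leb_outer_grad_le m' (m := m'.+1) p (phi : 'rV[R]_m -> R) (lambda D B r : R) V (T : set
  'rV[R]_m)
    (g1 g2 : 'rV[R]_m -> R) (e := D ^+ m / (16 * (15 * pi) ^+ m)) :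
  0 < D -> 1 <= p -> lambda != 0 ->
  (forall t, T t -> forall s : 'rV[R]_m, (forall i, `|s 0 i - t 0 i| <= D) -> V s) ->
  (forall t, T t -> forall s : 'rV[R]_m, (forall i, `|s 0 i - t 0 i| <= D) ->
     `|lambda * phi s - (lambda * phi t + dotR (lambda *: grad phi t) (s - t))| <= 4^-1) ->
  (forall t, T t -> forall i, `|partial i phi t| <= B) ->
  ift_eq_on V g1 g2 (fun s => cos (lambda * phi s)) (fun s => sin (lambda * phi s)) ->
  iint (fun u => (Num.sqrt (g1 u ^+ 2 + g2 u ^+ 2) `^ p)%:E) = r%:E ->
  (leb_outer (grad phi @` T) <=
     (16 * 120 ^+ m * e `^ (1 - p) * r * (D * `|lambda|)^-1 ^+ m)%:E)%E.
Proof.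
move=> D0 p1 l0 boxV lin gradB ift rE.
have l1 : 0 < `|lambda| by rewrite normr_gt0.
have Dl0 : 0 < D * `|lambda| by rewrite mulr_gt0.
pose h := (D * `|lambda|)^-1.
have h0 : 0 < h by rewrite invr_gt0.
(* Gradients on [T] have coordinates in [[- N h, N h)], so [2 N] cells per coordinate suffice and
   indices are shifted by [N]. *)
pose N := (Num.truncn (`|B| / h)).+1.
pose n := (N + N)%N.
pose cell (k : {ffun 'I_m -> 'I_n}) (xi : 'rV[R]_m) :=
  forall i, h * ((k i)%:R - N%:R) <= xi 0 i < h * ((k i)%:R - N%:R) + h.
pose H := [set k : {ffun 'I_m -> 'I_n} | `[< exists2 t, T t & cell k (grad phi t) >]]%SET.
have cover xi : (grad phi @` T) xi -> exists2 k, k \in H & cell k xi.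
  move=> [t Tt <-].
  have lb i : 0 <= grad phi t 0 i / h + N%:R < n%:R.
    have : `|grad phi t 0 i / h| < N%:R.
      apply: le_lt_trans (truncnS_gt _).
      have hi0 : 0 <= h^-1 by rewrite invr_ge0 ltW.
      rewrite normrM (ger0_norm hi0); apply: ler_wpM2r => //.
      by rewrite mxE (le_trans (gradB t Tt i))// ler_norm.
    by rewrite ltr_norml /n natrD => /andP[a1 a2]; lra.
  have jn i : (Num.truncn (grad phi t 0 i / h + N%:R)%R < n)%N.
    have /andP[a1 a2] := lb i.
    by rewrite -(ltr_nat R) (le_lt_trans _ a2)// truncn_le.
  pose k := [ffun i => Ordinal (jn i)].
  have kt : cell k (grad phi t).
    move=> i; rewrite ffunE /=.
    have /andP[a1 a2] := lb i.
    have b1 := truncnS_gt (grad phi t 0 i / h + N%:R).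
    have b2 : (Num.truncn (grad phi t 0 i / h + N%:R))%:R <= grad phi t 0 i / h + N%:R.
      by rewrite truncn_le.
    set x := grad phi t 0 i / h in a1 a2 b1 b2 *.
    have gx : grad phi t 0 i = h * x by rewrite /x mulrC divfK ?gt_eqF.
    rewrite gx; move: b1 b2; rewrite -natr1; move: ((Num.truncn (x + N%:R))%:R : R) => j b1 b2.
    rewrite (_ : h * (j - N%:R) + h = h * (j - N%:R + 1)); last by ring.
    rewrite ler_pM2l// ltr_pM2l//.
    by apply/andP; split; lra.
  by exists k => //; rewrite inE; apply/asboolP; exists t.
have grid : (leb_outer (grad phi @` T) <= (#|H|%:R * h ^+ m)%:E)%E.
  apply: (@leb_outer_grid R m' n H N%:R h _ (ltW h0)) => xi /cover[k kH kxi].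
  by exists k.
apply: (le_trans grid).
rewrite lee_fin -/h ler_wpM2r ?exprn_ge0 ?(ltW h0)//.
(* The mesh [h] involves [|lambda|]; the sign of [lambda] is moved into the centres [ka]. *)
pose s := Num.sg lambda.
have s2 : s ^+ 2 = 1 by rewrite sqr_sg l0.
pose ka (k : {ffun 'I_m -> 'I_n}) i := s * ((k i)%:R - N%:R).
pose P u := Num.sqrt (g1 u ^+ 2 + g2 u ^+ 2) `^ p.
have P0 u : 0 <= P u by exact: powR_ge0.
have e0 : 0 < e by rewrite divr_gt0 ?mulr_gt0 ?exprn_gt0 ?mulr_gt0 ?pi_gt0.
have ep0 : 0 < e `^ (1 - p) by exact: powR_gt0.
have loc k : k \in H -> ((8^-1 * D ^+ 2 ^+ m)%:E <=
    (e `^ (1 - p))%:E * iint (fun u => (P u * lorentz2 D (ka k) u)%:E))%E.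
  rewrite inE => /asboolP[t Tt kt].
  apply: (@local_lower_bound _ _ _ t (lambda *: grad phi t) D0 p phi lambda V) => //.
  - exact: boxV.
  - exact: lin.
  - move=> i; rewrite mxE /ka.
    have -> : D * (lambda * grad phi t 0 i) - s * ((k i)%:R - N%:R) =
        s * (h^-1 * grad phi t 0 i - ((k i)%:R - N%:R)).
      by rewrite /h invrK {1}(numEsg lambda) -/s; ring.
    rewrite normrM normr_sg l0 mul1r.
    have /andP[a1 a2] := kt i.
    have b1 : (k i)%:R - N%:R <= h^-1 * grad phi t 0 i by rewrite ler_pdivlMl.
    have b2 : h^-1 * grad phi t 0 i <= (k i)%:R - N%:R + 1.
      by rewrite ler_pdivrMl// mulrDr mulr1 ltW.
    by rewrite ler_norml; apply/andP; split; lra.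
have sumP : ((#|H|%:R * (8^-1 * D ^+ 2 ^+ m))%:E <=
    (e `^ (1 - p) * (2 * (120 * D ^+ 2) ^+ m * r))%:E)%E.
  apply: (@le_trans _ _ (\sum_(k in H) ((e `^ (1 - p))%:E *
      iint (fun u => (P u * lorentz2 D (ka k) u)%:E)))%E).
    rewrite (_ : _%:E = \sum_(k in H) (8^-1 * D ^+ 2 ^+ m)%:E)%E; last first.
      by rewrite sumEFin sumr_const mulr_natl.
    by apply: lee_sum.
  rewrite -ge0_sume_distrr; last first.
    by move=> k _; apply: iint_ge0 => u; rewrite lee_fin mulr_ge0// lorentz2_ge0.
  rewrite [in leRHS]EFinM lee_pmul2l//.
  (* Superadditivity brings the sum under the integral, where the kernels are summed pointwise in
     [u]. *)
  apply: (le_trans (iint_sum_ge _ _ _)).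
    by move=> k u; rewrite lee_fin mulr_ge0// lorentz2_ge0.
  rewrite EFinM -rE -iintZl; last 2 first.
  - by rewrite !mulr_gt0// exprn_gt0// mulr_gt0// exprn_gt0.
  - by move=> u; rewrite lee_fin P0.
  apply: le_iint => u; rewrite sumEFin -EFinM lee_fin -mulr_sumr mulrC ler_wpM2r//.
  apply: (@le_trans _ _ (\sum_k lorentz2 D (ka k) u)).
    rewrite [leRHS](bigID (mem H))/= lerDl.
    by apply: sumr_ge0 => k _; exact: lorentz2_ge0.
  (* The two halves of [lorentz2] are grid sums with signs [s] and [- s]. *)
  rewrite big_split /= mulr2n mulrDl mul1r lerD//; first exact: sum_prod_lorentz_le.
  have := @sum_prod_lorentz_le R m n N%:R D (- s) u.
  rewrite sqrrN => /(_ s2); congr (_ <= _).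
  by apply: eq_bigr => k _; apply: eq_bigr => i _; rewrite mulNr.
move: sumP; rewrite lee_fin (exprMn m 120 (D ^+ 2)).
have X0 : 0 < D ^+ 2 ^+ m by rewrite !exprn_gt0.
move: (D ^+ 2 ^+ m) (120 ^+ m) X0 => X Y X0 hX.
rewrite -(ler_pM2r X0); lra.
Qed.

End global.

(** * Uniform constants, monotonicity of the inverse of [chi], and exponents *)

Section final.
Variable R : realType.

Lemma enorm_le_box m (x : 'rV[R]_m) D : (0 < m)%N -> 0 <= D ->
  (forall i, `|x 0 i| <= D) -> enorm x <= m%:R * D.
Proof.
move=> m0 D0 hx; rewrite /enorm -(ger0_norm (_ : 0 <= m%:R * D)) ?mulr_ge0//.
rewrite -sqrtr_sqr ler_wsqrtr// exprMn.
apply: (@le_trans _ _ (\sum_(i < m) D ^+ 2)).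
  apply: ler_sum => i _; rewrite -expr2 -real_normK ?num_real//.
  by apply: lerXn2r; rewrite ?nnegrE.
rewrite sumr_const card_ord -[leLHS]mulr_natl ler_wpM2r ?sqr_ge0//.
by rewrite -natrX ler_nat leq_pmulr.
Qed.

(** Here the size of a cube inside [V] and the bound on the gradient are uniform in the point;
    [n.+1] keeps the radius positive at [n = 0]. *)
Definition deep m (V : set 'rV[R]_m) (phi : 'rV[R]_m -> R) (n : nat) : set 'rV[R]_m :=
  [set t : 'rV[R]_m | (forall s : 'rV[R]_m, (forall i, `|s 0 i - t 0 i| <= n.+1%:R^-1) -> V s) /\
           (forall i, `|partial i phi t| <= n%:R)].

Lemma open_eq_bigcup_deep m (V : set 'rV[R]_m) phi : open V -> V = \bigcup_n deep V phi n.
Proof.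
move=> oV; apply/seteqP; split => t; last first.
  by move=> [n _ [h _]]; apply: h => i; rewrite subrr normr0.
move=> Vt; have : nbhs t V by exact: open_nbhs_nbhs.
move=> /nbhs_ballP[e /= e0 eV].
pose B := \sum_(i < m) `|partial i phi t|.
have B0 : 0 <= B by apply: sumr_ge0.
(* This index exceeds both the bound [B] on the partial derivatives and the inverse of the radius
   [e]. *)
exists (Num.truncn (B + e^-1)).+1 => //; split.
  move=> s st; apply: eV; split => // i j; rewrite (ord1 i).
  rewrite /ball /= distrC (le_lt_trans (st j))//.
  rewrite invf_plt ?posrE//; apply: (@lt_trans _ _ (Num.truncn (B + e^-1)).+1%:R).
    by apply: (le_lt_trans _ (truncnS_gt _)); rewrite lerDr.
  by rewrite ltr_nat.
move=> i; apply: (@le_trans _ _ B).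
  by rewrite /B (bigD1 i)//= lerDl; apply: sumr_ge0.
by apply: ltW; apply: (le_lt_trans _ (truncnS_gt _)); rewrite lerDl invr_ge0 ltW.
Qed.

Lemma C1omega_uniform m omega (V : set 'rV[R]_m) phi :
  (forall x, 0 <= x -> 0 <= omega x) ->
  C1omega omega V phi -> exists C d, [/\ 0 < C, 0 < d &
    forall (k : 'I_m) x, 0 < x -> x <= d -> forall t1 t2, V t1 -> V t2 ->
      enorm (t1 - t2) <= x -> `|partial k phi t1 - partial k phi t2| <= C * omega x].
Proof.
move=> om0 [_ /choice[C /choice[d hCd]]].
(* The second value lies below every [d k], and the first above every [C k]; the summands 1 make
   both positive. *)
exists (1 + \sum_k `|C k|), (1 + \sum_k (d k)^-1)^-1.
have d0 k : 0 < (d k)^-1 by rewrite invr_gt0; have [] := hCd k.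
have S0 : 0 <= \sum_k (d k)^-1 by apply: sumr_ge0 => k _; exact: ltW.
split.
- by rewrite ltr_pwDl// sumr_ge0.
- by rewrite invr_gt0 ltr_pwDl.
move=> k x x0 xd t1 t2 V1 V2 h12; have [dk0 hk] := hCd k.
have xdk : x <= d k.
  apply: (le_trans xd); rewrite invf_ple ?posrE ?ltr_pwDl//.
  apply: (@le_trans _ _ (\sum_k (d k)^-1)); last by rewrite lerDr.
  by rewrite [leRHS](bigD1 k)//= lerDl; apply: sumr_ge0 => j _; exact: ltW.
apply: (le_trans (hk x x0 xdk t1 t2 V1 V2 h12)); rewrite ler_wpM2r ?om0 ?(ltW x0)//.
apply: (le_trans (ler_norm _)); apply: (@le_trans _ _ (\sum_k `|C k|)); last by rewrite lerDr.
by rewrite [leRHS](bigD1 k)//= lerDl; apply: sumr_ge0.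
Qed.

Lemma chiinv_gt0 (omega chiinv : R -> R) y :
  (forall z, 0 <= z -> 0 <= chiinv z /\ chiinv z * omega (chiinv z) = z) ->
  0 < y -> 0 < chiinv y.
Proof.
move=> hchi y0; have [h0 h1] := hchi y (ltW y0).
by rewrite lt_neqAle h0 andbT eq_sym; apply/eqP => h; move: h1; rewrite h mul0r => /eqP; rewrite
  eq_sym gt_eqF.
Qed.

(** Where [omega] is positive, [x * omega x] is strictly increasing, so a reversed order of the
    preimages would force [y2 < y1]. *)
Lemma chiinv_le (omega chiinv : R -> R) y1 y2 :
  (forall x y, 0 <= x -> x <= y -> omega x <= omega y) ->
  (forall z, 0 <= z -> 0 <= chiinv z /\ chiinv z * omega (chiinv z) = z) ->
  0 < y1 -> y1 <= y2 -> chiinv y1 <= chiinv y2.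
Proof.
move=> mono hchi y0 y12; have y20 := lt_le_trans y0 y12.
rewrite leNgt; apply/negP => lt21.
have x1 := chiinv_gt0 hchi y0; have x2 := chiinv_gt0 hchi y20.
have [_ e1] := hchi _ (ltW y0); have [_ e2] := hchi _ (ltW y20).
have om2 : 0 < omega (chiinv y2) by rewrite -(pmulr_rgt0 _ x2) e2.
have om12 := mono _ _ (ltW x2) (ltW lt21).
have : y2 < y1.
  rewrite -e1 -e2; apply: (@lt_le_trans _ _ (chiinv y1 * omega (chiinv y2))).
    by rewrite ltr_pM2r.
  by rewrite ler_pM2l.
by rewrite ltNge y12.
Qed.

(** Turns the measure bound into the norm bound: multiply by [K^(1-p) X^(mp) l^m], where the powers
    of [X] cancel as [m(1-p) + mp - m = 0], and take the root of order [p]. *)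
Lemma powR_root_bound m (p K c l X r : R) : 1 <= p -> 0 < K -> 0 < c -> 0 < l ->
  0 < X -> 0 <= r ->
  c <= (X ^+ m / K) `^ (1 - p) * r * (X * l)^-1 ^+ m ->
  ((c * K `^ (1 - p)) `^ p^-1) * (X * l `^ p^-1) ^+ m <= r `^ p^-1.
Proof.
move=> p1 K0 c0 l0 X0 r0 h.
have p0 : 0 < p by exact: lt_le_trans p1.
have Xm : 0 < X ^+ m by exact: exprn_gt0.
have lm : 0 < l ^+ m by exact: exprn_gt0.
have e1 : (l `^ p^-1) ^+ m = (l ^+ m) `^ p^-1.
  by rewrite -(powR_mulrn m (powR_ge0 l p^-1)) -(powR_mulrn m (ltW l0)) -!powRrM mulrC.
have e2 : X ^+ m = ((X ^+ m) `^ p) `^ p^-1 by rewrite -powRrM divff ?gt_eqF// powRr1// ltW.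
rewrite exprMn e1 [X in _ * (X * _)]e2 -!powRM ?mulr_ge0 ?powR_ge0 ?(ltW lm) ?(ltW c0)//.
apply: ge0_ler_powR; rewrite ?nnegrE ?invr_ge0 ?mulr_ge0 ?powR_ge0 ?(ltW lm) ?(ltW c0) ?(ltW p0)//.
have K1 : (X ^+ m / K) `^ (1 - p) * K `^ (1 - p) = (X ^+ m) `^ (1 - p).
  by rewrite -powRM ?divr_ge0 ?(ltW K0) ?(ltW Xm)// divfK ?gt_eqF.
have X1 : (X ^+ m) `^ (1 - p) * (X ^+ m) `^ p = X ^+ m.
  by rewrite -powRD ?(gt_eqF Xm) ?implybT// subrK powRr1// ltW.
apply: (@le_trans _ _ (((X ^+ m / K) `^ (1 - p) * r * (X * l)^-1 ^+ m) *
    K `^ (1 - p) * ((X ^+ m) `^ p * l ^+ m))).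
  by rewrite !ler_wpM2r ?mulr_ge0 ?powR_ge0 ?(ltW lm).
rewrite (_ : _ * _ * _ = ((X ^+ m / K) `^ (1 - p) * K `^ (1 - p)) * (X ^+ m) `^ p * r *
   ((X * l)^-1 ^+ m * l ^+ m)); last by ring.
have Xl : (X * l)^-1 ^+ m * l ^+ m = (X ^+ m)^-1.
  by rewrite -exprMn invfM divfK ?gt_eqF// exprVn.
by rewrite K1 X1 Xl mulrAC divff ?gt_eqF// mul1r.
Qed.

End final.

(** * Choice of the scale [D] and conclusion *)

Theorem mainTheorem5 (R : realType) (m : nat) (p : R)
  (omega : R -> R) (chiinv : R -> R)
  (V : set 'rV[R]_m) (phi : 'rV[R]_m -> R) :
  (1 <= m)%N -> 1 <= p -> p < 2 ->
  {within [set x : R | 0 <= x], continuous omega} ->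
  (forall x y : R, 0 <= x -> x <= y -> omega x <= omega y) ->
  omega 0 = 0 ->
  (forall y : R, 0 <= y -> 0 <= chiinv y /\ chiinv y * omega (chiinv y) = y) ->
  domain V ->
  C1omega omega V phi ->
  (0 < leb_outer (grad phi @` V))%E ->
  exists c : R, 0 < c /\
    forall lambda : R, 1 <= `|lambda| ->
      in_Ap_on p V (fun t => cos (lambda * phi t)) (fun t => sin (lambda * phi t)) ->
      ((c * (powR `|lambda| p^-1 * chiinv `|lambda|^-1) ^+ m)%:E
         <= Ap_norm_on p V (fun t => cos (lambda * phi t))
                           (fun t => sin (lambda * phi t)))%E.
Proof.
case: m V phi => [//|m] V phi _ p1 _ _ mono om0 hchi [oV _ _] hC1 posV.
have omge0 x : 0 <= x -> 0 <= omega x by move=> x0; rewrite -om0; exact: mono.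
have [C [d [C0 d0 hC]]] := C1omega_uniform omge0 hC1.
have [dphi _] := hC1.
have [n posn] : exists n, (0 < leb_outer (grad phi @` deep V phi n))%E.
  by apply: exists_leb_outer_gt0; rewrite -image_bigcup -open_eq_bigcup_deep.
(* A finite [l] is extracted because the outer measure may be infinite. *)
have [l l0 hl] : exists2 l : R, 0 < l & (l%:E <= leb_outer (grad phi @` deep V phi n))%E.
  move: posn; case: (leb_outer _) => [x| |]//.
    by rewrite lte_fin => x0; exists x.
  by move=> _; exists 1 => //; rewrite leey.
pose M : R := m.+1%:R.
have M0 : 0 < M by rewrite ltr0n.
pose X1 := chiinv 1.
have X10 : 0 < X1 by apply: chiinv_gt0 hchi _.
(* With [D = X / E] and [X <= X1], the successive summands after 1 secure [D <= 1/(n+1)],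
   [M D <= d], [M D <= X] and [M C / E <= 1/4]. *)
pose E := 1 + n.+1%:R * X1 + M * X1 / d + M + 4 * M * C.
have E1 : 0 <= n.+1%:R * X1 by rewrite mulr_ge0// ltW.
have E2 : 0 <= M * X1 / d by rewrite divr_ge0 ?mulr_ge0 ?ltW.
have E3 : 0 <= 4 * M * C by rewrite !mulr_ge0// ltW.
have E0 : 0 < E by rewrite /E; lra.
pose eps := E^-1.
have eps0 : 0 < eps by rewrite invr_gt0.
have epsE : eps * E = 1 by rewrite mulVf// gt_eqF.
pose K : R := 16 * (15 * pi) ^+ m.+1.
have K0 : 0 < K by rewrite mulr_gt0// exprn_gt0// mulr_gt0// pi_gt0.
pose A : R := 16 * 120 ^+ m.+1.
have A0 : 0 < A by rewrite mulr_gt0// exprn_gt0.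
have p0 : 0 < p by exact: lt_le_trans p1.
exists ((l / A * K `^ (1 - p)) `^ p^-1 * eps ^+ m.+1); split.
  by rewrite mulr_gt0 ?exprn_gt0// powR_gt0// mulr_gt0 ?divr_gt0// powR_gt0.
move=> lambda l1 _.
have la0 : 0 < `|lambda| by exact: lt_le_trans l1.
have il0 : 0 < `|lambda|^-1 by rewrite invr_gt0.
have il1 : `|lambda|^-1 <= 1 by rewrite invf_le1.
pose X := chiinv `|lambda|^-1.
have X0 : 0 < X by apply: chiinv_gt0 hchi _.
have XX1 : X <= X1 by apply: chiinv_le mono hchi _ _.
have chiX : X * omega X = `|lambda|^-1 by have [] := hchi _ (ltW il0).
pose D := eps * X.
have D0 : 0 < D by rewrite mulr_gt0.
have Dle a : 0 <= a -> a * X1 <= E -> a * D <= 1.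
  move=> a0 aE; rewrite -epsE /D mulrCA ler_pM2l//; apply: le_trans aE.
  by rewrite ler_wpM2l.
have Dn : D <= n.+1%:R^-1.
  rewrite -[n.+1%:R^-1]mul1r ler_pdivlMr// mulrC; apply: Dle => //.
  by rewrite /E; lra.
have MDd : M * D <= d.
  rewrite -[d]mul1r -ler_pdivrMr// mulrAC; apply: Dle; first by rewrite divr_ge0 ?ltW.
  by rewrite mulrAC /E; lra.
have MDX : M * D <= X.
  rewrite /D mulrA -[leRHS]mul1r ler_pM2r// -epsE mulrC ler_pM2l//.
  by rewrite /E; lra.
have MC : M * eps * C <= 4^-1.
  have : eps * (4 * M * C) <= 1 by rewrite -[leRHS]epsE ler_pM2l// /E; lra.
  lra.
have MD0 : 0 < M * D by rewrite mulr_gt0.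
apply: le_ereal_inf_tmp => _ [[g1 g2] [[_ [_ fin]] ift] <-].
rewrite [leRHS](_ : _ = Lp_norm p g1 g2)// /Lp_norm; move: fin ift.
rewrite [X in (X < _)%E -> _](_ : _ = iint (fun u => (Num.sqrt (g1 u ^+ 2 + g2 u ^+ 2) `^
  p)%:E))// => fin ift.
have I0 : (0 <= iint (fun u => (Num.sqrt (g1 u ^+ 2 + g2 u ^+ 2) `^ p)%:E))%E.
  by apply: iint_ge0 => u; rewrite lee_fin powR_ge0.
move: I0 fin; case IE : (iint _) => [r| |]// r0 _.
rewrite poweR_EFin lee_fin.
have boxV t : deep V phi n t -> forall s : 'rV[R]_m.+1,
    (forall i, `|s 0 i - t 0 i| <= D) -> V s.
  by move=> [h _] s st; apply: h => i; apply: (le_trans (st i)).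
have lin t : deep V phi n t -> forall s : 'rV[R]_m.+1,
    (forall i, `|s 0 i - t 0 i| <= D) ->
    `|lambda * phi s - (lambda * phi t + dotR (lambda *: grad phi t) (s - t))| <= 4^-1.
  move=> Tt s st.
  have -> : dotR (lambda *: grad phi t) (s - t) = lambda * dotR (grad phi t) (s - t).
    by rewrite /dotR mulr_sumr; apply: eq_bigr => i _; rewrite mxE mulrA.
  rewrite opprD addrA -!mulrBr normrM.
  have Vt : V t by apply: (boxV t Tt t) => i; rewrite subrr normr0 ltW.
  (* The cube lies within Euclidean distance [M D <= X] of [t], so the error is at most
     [|lambda| M C omega(X) D = M eps C], because [X omega(X) = 1 / |lambda|]. *)
  have fob := @first_order_bound R m.+1 phi t s D (C * omega (M * D)).
  apply: (@le_trans _ _ (`|lambda| * (m.+1%:R * (C * omega (M * D) * D)))).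
    apply: ler_wpM2l => //; apply: fob => //.
    - by move=> z k zt; apply: dphi; exact: boxV zt.
    - move=> z k zt; apply: (hC k _ MD0 MDd) => //; first exact: boxV zt.
      by apply: enorm_le_box => //; [exact: ltW|move=> i; rewrite !mxE; exact: zt].
  have omX : omega (M * D) <= omega X by apply: mono => //; exact: ltW.
  apply: (@le_trans _ _ (`|lambda| * (M * (C * omega X * D)))).
    by rewrite !ler_wpM2l ?(ltW M0)// ler_wpM2r ?(ltW D0)// ler_wpM2l// ltW.
  rewrite [leLHS](_ : _ = (M * eps * C) * (`|lambda| * (X * omega X))); last by rewrite /D; ring.
  by rewrite chiX divff ?gt_eqF// mulr1.
have gradB t : deep V phi n t -> forall i, `|partial i phi t| <= n%:R by case.
have ln0 : lambda != 0 by rewrite -normr_gt0.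
have main := le_trans hl (leb_outer_grad_le D0 p1 ln0 boxV lin gradB ift IE).
rewrite lee_fin -/A -/K in main.
(* The factor [eps^m] of the constant turns [X] into [D]. *)
rewrite -mulrA -exprMn (_ : eps * _ = D * `|lambda| `^ p^-1); last by rewrite /D -/X; ring.
apply: powR_root_bound => //; first by rewrite divr_gt0.
by rewrite ler_pdivrMr// mulrC !mulrA.
Qed.
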